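(* Let the family of weights $(w(a))_{a>0}$, $w(a)=(w_n(a))_{n\geq1}$, be defined either by $w_1(a)\cdots w_n(a)=n^a$ for all $n\geq 1$ and $a>0$, or by $w_n(a)=1+\frac an$ for all $n\geq1$ and $a>0$. Then, for all $d\geq 1$, the family $\big(B_{w(\lambda_1)}\times\cdots\times B_{w(\lambda_d)}\big)_{\lambda=(\lambda_1,\dots,\lambda_d)\in(0,+\infty)^d}$ admits a common hypercyclic algebra on $\ell_1(\mathbb N)^d$ with the convolution product.
   Context: Sequences are complex and indexed by $n\ge 0$. For a sequence $w=(w_n)_{n\geq 1}$ of positive real numbers, the weighted backward shift is $B_w(x_0,x_1,x_2,\dots)=(w_1x_1,w_2x_2,\dots)$; $B_{w(\lambda_1)}\times\cdots\times B_{w(\lambda_d)}$ acts on $\ell_1(\mathbb N)^d$ by $(x^{(1)},\dots,x^{(d)})\mapsto(B_{w(\lambda_1)}x^{(1)},\dots,B_{w(\lambda_d)}x^{(d)})$. The convolution (Cauchy) product of sequences is $(a_n)_n\cdot(b_n)_n=\big(\sum_{k=0}^n a_kb_{n-k}\big)_n$; $\ell_1(\mathbb N)^d$ is an algebra with this product applied in each of its $d$ components. A vector $x$ is hypercyclic for an operator $T$ if $\{T^n(x):n\geq 1\}$ is dense in the space; $HC(T)$ is the set of hypercyclic vectors of $T$. A family $(T_\lambda)_{\lambda\in\Lambda}$ of operators on a topological algebra $Y$ admits a common hypercyclic algebra if there is a non-trivial (i.e. nonzero) subalgebra $A$ of $Y$ with $A\setminus\{0\}\subset\bigcap_{\lambda\in\Lambda}HC(T_\lambda)$.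 *)

(* Defs.v *)
From HB Require Import structures.
From mathcomp Require Import all_boot all_order all_algebra.
From mathcomp Require Import all_classical all_reals all_analysis.
From mathcomp Require Import complex.

Set Implicit Arguments.
Unset Strict Implicit.
Unset Printing Implicit Defensive.

Import Order.TTheory GRing.Theory Num.Theory.
Import numFieldNormedType.Exports.
Import Normc.

Local Open Scope classical_set_scope.
Local Open Scope complex_scope.
Local Open Scope ring_scope.

Section L1.
Variable R : realType.
Local Notation C := R[i].
Implicit Types x y z : nat -> C.

(* [normc] is the modulus with values in [R], whereas [`| _ |] on [R[i]] takes
   values in [R[i]]. *)
Definition l1_enorm x : \bar R := (\sum_(0 <= n <oo) (normc (x n))%:E)%E.

Definition l1_pred : {pred nat -> C} := fun x => `[< (l1_enorm x < +oo)%E >].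

Definition conv x y : nat -> C := fun n => \sum_(k < n.+1) x k * y (n - k)%N.

Lemma normc_normr (c : C) : `|c| = (normc c)%:C.
Proof. by []. Qed.

Lemma normc_ge0' (c : C) : 0 <= normc c.
Proof. by rewrite -ler0c -normc_normr. Qed.

Lemma normc_ge0E (c : C) : (0 <= (normc c)%:E)%E.
Proof. by rewrite lee_fin normc_ge0'. Qed.

Lemma l1_enorm_ge0 x : (0 <= l1_enorm x)%E.
Proof. by apply: nneseries_ge0 => n _ _; exact: normc_ge0E. Qed.

Lemma l1_enormD x y : (l1_enorm (x + y)%R <= l1_enorm x + l1_enorm y)%E.
Proof.
rewrite /l1_enorm -nneseriesD; try by move=> n *; exact: normc_ge0E.
apply: lee_nneseries => n *; first exact: normc_ge0E.
by rewrite -EFinD lee_fin -lecR rmorphD/= -!normc_normr ler_normD.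
Qed.

Lemma l1_enormZ (c : C) x : l1_enorm (c *: x)%R = ((normc c)%:E * l1_enorm x)%E.
Proof.
rewrite /l1_enorm -nneseriesZl; last by move=> n *; exact: normc_ge0E.
by apply: eq_eseriesr => n _; rewrite -EFinM -normcM.
Qed.

Lemma l1_enorm_ge x n : ((\sum_(0 <= k < n) normc (x k))%:E <= l1_enorm x)%E.
Proof.
rewrite -sumEFin; apply: nneseries_lim_ge => k *; exact: normc_ge0E.
Qed.

Lemma l1_enorm_le x (M : \bar R) :
  (forall n, ((\sum_(0 <= k < n) normc (x k))%:E <= M)%E) -> (l1_enorm x <= M)%E.
Proof.
move=> xM; apply: lime_le.
  by apply: is_cvg_nneseries => n *; exact: normc_ge0E.
by apply: nearW => n; rewrite sumEFin.
Qed.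

Lemma l1_predP x : reflect (l1_enorm x < +oo)%E (x \in l1_pred).
Proof. exact: asboolP. Qed.

Lemma l1_submod_closed : submod_closed l1_pred.
Proof.
split.
  apply/l1_predP; apply: (@le_lt_trans _ _ 0%E) => //.
  by apply: l1_enorm_le => n; rewrite big1 // => k _; rewrite normc0.
move=> c x y /l1_predP xoo /l1_predP yoo; apply/l1_predP.
apply: le_lt_trans (l1_enormD _ _) _; rewrite l1_enormZ lte_add_pinfty//.
by rewrite lte_mul_pinfty// ?normc_ge0E.
Qed.

HB.instance Definition _ :=
  GRing.isSubmodClosed.Build C (nat -> C) l1_pred
    (GRing.submod_closed_semi l1_submod_closed).

Lemma l1_enorm_conv x y :
  (l1_enorm (conv x y) <= l1_enorm x * l1_enorm y)%E.
Proof.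
apply: l1_enorm_le => n.
apply: (@le_trans _ _ ((\sum_(0 <= k < n) normc (x k))%:E *
                       (\sum_(0 <= k < n) normc (y k))%:E)%E); last first.
  by apply: lee_pmul; rewrite ?l1_enorm_ge// lee_fin;
     apply: sumr_ge0 => *; exact: normc_ge0'.
rewrite -EFinM lee_fin.
apply: (@le_trans _ _ (\sum_(0 <= m < n) \sum_(0 <= k < n | (k <= m)%N)
            normc (x k) * normc (y (m - k)%N))).
  rewrite !big_mkord; apply: ler_sum => m _.
  rewrite -lecR -normc_normr (le_trans (ler_norm_sum _ _ _))//.
  rewrite rmorph_sum/= big_nat_cond.
  rewrite (eq_bigr (fun k : 'I_m.+1 => (fun k => (normc (x k) * normc (y (m - k)%N))%:C) k)); last first.
    by move=> k _; rewrite normrM rmorphM.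
  rewrite -(big_mkord xpredT (fun k => (normc (x k) * normc (y (m - k)%N))%:C)).
  rewrite [leLHS]big_nat_cond (big_nat_widen _ _ n)/=; last exact: ltn_ord.
  rewrite le_eqVlt; apply/orP; left; apply/eqP; apply: eq_bigl => k.
  have mn : (m < n)%N by exact: ltn_ord.
  by rewrite /= ltnS andbT andbb; case: (leqP k m) => km; rewrite ?andbF// (leq_ltn_trans km).
rewrite (exchange_big_dep_nat xpredT)//= big_distrl/=.
rewrite !big_mkord; apply: ler_sum => k _.
rewrite -mulr_sumr ler_wpM2l ?normc_ge0'//.
have kn : (k <= n)%N by exact: ltnW.
rewrite -(big_nat_widenl _ _ _ xpredT)// -{1}[nat_of_ord k]add0n big_addn.
rewrite -(big_mkord xpredT (fun i => normc (y i))) [leRHS](big_cat_nat (n := (n - k)%N) _ (leq_subr k n))//=.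
under eq_bigr do rewrite addnK.
by rewrite lerDl sumr_ge0// => *; exact: normc_ge0'.
Qed.

Lemma conv_l1 x y : x \in l1_pred -> y \in l1_pred -> conv x y \in l1_pred.
Proof.
move=> /l1_predP xoo /l1_predP yoo; apply/l1_predP.
apply: le_lt_trans (l1_enorm_conv _ _) _.
by rewrite lte_mul_pinfty// ?l1_enorm_ge0// ge0_fin_numE ?l1_enorm_ge0.
Qed.

Lemma conv_coefM x y N n : (n < N)%N ->
  conv x y n = ((\poly_(i < N) x i) * (\poly_(i < N) y i))`_n.
Proof.
move=> nN; rewrite coefM; apply: eq_bigr => k _.
by rewrite !coef_poly !ifT// (leq_ltn_trans _ nN)// ?leq_subr// -ltnS ltn_ord.
Qed.

Lemma convC : commutative conv.
Proof.
by move=> x y; apply/funext => n; rewrite !(@conv_coefM _ _ n.+1)// mulrC.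
Qed.

Lemma convA : associative conv.
Proof.
move=> x y z; apply/funext => n.
pose P u := \poly_(i < n.+1) (u i : C).
transitivity ((P x * (P y * P z))`_n).
  rewrite coefM; apply: eq_bigr => k _.
  by rewrite coef_poly ltn_ord (@conv_coefM _ _ n.+1)// ltnS leq_subr.
rewrite mulrA coefM; apply: eq_bigr => k _.
by rewrite coef_poly ifT ?(@conv_coefM _ _ n.+1)// ?ltn_ord// ltnS leq_subr.
Qed.

Definition conv1 : nat -> C := fun n => (n == 0)%:R.

Lemma conv1_l1 : conv1 \in l1_pred.
Proof.
apply/l1_predP; apply: (@le_lt_trans _ _ 1%E); last exact: ltry.
apply: l1_enorm_le => -[|n]; first by rewrite big_nil lee_fin.
rewrite big_nat_recl// big1 => [|k _]; last exact: normc0.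
by rewrite addr0 lee_fin (normc1 R).
Qed.

Lemma conv1x : left_id conv1 conv.
Proof.
move=> x; apply/funext => n; rewrite /conv big_ord_recl/= subn0 mul1r.
by rewrite big1 ?addr0// => k _; rewrite mul0r.
Qed.

Lemma convDl : left_distributive conv +%R.
Proof.
move=> x y z; apply/funext => n; rewrite /conv [RHS]/GRing.add/=.
by rewrite -big_split/=; apply: eq_bigr => k _; rewrite -mulrDl.
Qed.

Lemma convZl (c : C) x y : c *: conv x y = conv (c *: x) y.
Proof.
apply/funext => n; rewrite /conv [LHS]/GRing.scale/= scaler_sumr.
by apply: eq_bigr => k _; rewrite scalerAl.
Qed.

Record l1 := L1 { l1_val :> nat -> C ; l1_valP : l1_val \in l1_pred }.

HB.instance Definition _ := [isSub for l1_val].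
HB.instance Definition _ := [Choice of l1 by <:].
HB.instance Definition _ := [SubChoice_isSubLmodule of l1 by <:].

Definition l1_norm (x : l1) : C := (fine (l1_enorm x))%:C.

Lemma l1_fin (x : l1) : l1_enorm x \is a fin_num.
Proof. by rewrite ge0_fin_numE ?l1_enorm_ge0//; apply/l1_predP/l1_valP. Qed.

Lemma l1_normD (x y : l1) : l1_norm (x + y) <= l1_norm x + l1_norm y.
Proof.
rewrite /l1_norm -rmorphD/= lecR -fineD ?l1_fin//; apply: fine_le.
- exact: (l1_fin (x + y)).
- by rewrite fin_numD !l1_fin.
- exact: l1_enormD.
Qed.

Lemma l1_normZ (c : C) (x : l1) : l1_norm (c *: x) = `|c| * l1_norm x.
Proof. by rewrite /l1_norm l1_enormZ fineM ?l1_fin// rmorphM. Qed.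

Lemma l1_norm0_eq0 (x : l1) : l1_norm x = 0 -> x = 0.
Proof.
move=> /(congr1 (@complex.Re R))/= x0; apply/val_inj/funext => n /=.
apply/eq0_normc/le_anti; rewrite normc_ge0' andbT -x0 -lee_fin fineK ?l1_fin//.
apply: le_trans (l1_enorm_ge x n.+1); rewrite lee_fin big_nat_recr//=.
by rewrite lerDr sumr_ge0// => *; exact: normc_ge0'.
Qed.

HB.instance Definition _ :=
  Lmodule_isNormed.Build C l1 l1_normD l1_normZ l1_norm0_eq0.

Definition l1_mul (x y : l1) : l1 := L1 (conv_l1 (l1_valP x) (l1_valP y)).
Definition l1_one : l1 := L1 conv1_l1.

Let l1_mulA : associative l1_mul.
Proof. by move=> x y z; apply/val_inj/convA. Qed.
Let l1_mulC : commutative l1_mul.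
Proof. by move=> x y; apply/val_inj/convC. Qed.
Let l1_mul1 : left_id l1_one l1_mul.
Proof. by move=> x; apply/val_inj/conv1x. Qed.
Let l1_mulDl : left_distributive l1_mul +%R.
Proof. by move=> x y z; apply/val_inj/convDl. Qed.
Let l1_one_neq0 : l1_one != 0.
Proof.
by apply/eqP => /(congr1 (fun x : l1 => x 0%N))/eqP/=; rewrite oner_eq0.
Qed.

HB.instance Definition _ := GRing.Zmodule_isComNzRing.Build l1
  l1_mulA l1_mulC l1_mul1 l1_mulDl l1_one_neq0.

Let l1_scaleAl (c : C) (x y : l1) : c *: (x * y) = (c *: x) * y.
Proof. by apply/val_inj/convZl. Qed.

HB.instance Definition _ := GRing.Lmodule_isLalgebra.Build C l1 l1_scaleAl.
HB.instance Definition _ := GRing.Lalgebra_isComAlgebra.Build C l1.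

Definition l1_pow (d : nat) : Type := 'I_d -> l1.

HB.instance Definition _ d := GRing.Lmodule.on (l1_pow d).
HB.instance Definition _ d := GRing.ComPzRing.on (l1_pow d).
HB.instance Definition _ d :=
  Topological.copy (l1_pow d) (prod_topology (fun _ : 'I_d => l1)).

(* [w 0] is irrelevant: weight sequences are indexed from 1. *)
Definition bounded_weight (w : nat -> R) : Prop :=
  exists M : R, forall n, (1 <= n)%N -> `|w n| <= M.

Lemma wshift_l1 (w : nat -> R) (wb : bounded_weight w) (x : l1) :
  (fun n => (w n.+1)%:C * x n.+1) \in l1_pred.
Proof.
have [M wM] := wb; have M0 : 0 <= M by apply: le_trans (wM 1%N _).
apply/l1_predP; apply: (@le_lt_trans _ _ (M%:E * l1_enorm x)%E); last first.
  by rewrite lte_mul_pinfty// ltey_eq l1_fin.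
apply: l1_enorm_le => n.
apply: (@le_trans _ _ (M%:E * (\sum_(0 <= k < n.+1) normc (x k))%:E)%E).
  rewrite -EFinM lee_fin big_nat_recl//= mulrDr mulr_sumr.
  rewrite -[leLHS]add0r lerD ?mulr_ge0 ?normc_ge0'//.
  apply: ler_sum => k _; rewrite normcM ler_wpM2r ?normc_ge0'//.
  by rewrite -lecR -normc_normr normc_def/= expr0n/= addr0 sqrtr_sqr lecR wM.
by rewrite lee_wpmul2l ?lee_fin// l1_enorm_ge.
Qed.

Definition wshift (w : nat -> R) (wb : bounded_weight w) (x : l1) : l1 :=
  L1 (wshift_l1 wb x).

Definition prod_wshift (d : nat) (w : 'I_d -> nat -> R)
    (wb : forall i, bounded_weight (w i)) (x : l1_pow d) : l1_pow d :=
  fun i => wshift (wb i) (x i).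

(* The products determine [w a n] for [n >= 1] and force it to be positive. *)
Definition power_weights (w : {posnum R} -> nat -> R) : Prop :=
  forall (a : {posnum R}) n, (1 <= n)%N ->
    \prod_(1 <= k < n.+1) w a k = n%:R `^ a%:num.

Definition linear_weights (w : {posnum R} -> nat -> R) : Prop :=
  forall (a : {posnum R}) n, (1 <= n)%N -> w a n = 1 + a%:num / n%:R.

Lemma weights_bounded (w : {posnum R} -> nat -> R) :
  power_weights w \/ linear_weights w -> forall a, bounded_weight (w a).
Proof.
move=> [wE|wE] a; last first.
  exists (1 + a%:num) => n n1; rewrite wE// ger0_norm ?addr_ge0 ?divr_ge0//.
  by rewrite lerD2l ler_pdivrMr ?ltr0n// ler_peMr// ler1n.
exists (2%:R `^ a%:num) => -[//|[|n]] _.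
  have := wE a 1%N isT; rewrite big_nat1 => ->; rewrite ger0_norm ?powR_ge0//.
  by rewrite ge0_ler_powR// ?nnegrE ?ler_nat.
have := wE a n.+2 isT; rewrite big_nat_recr//= wE// => wn.
have p0 : 0 < n.+1%:R `^ a%:num :> R by rewrite powR_gt0// ltr0n.
rewrite -(ler_pM2l p0) -[X in X * `|_|]gtr0_norm// -normrM wn.
rewrite ger0_norm ?powR_ge0// -powRM//.
rewrite ge0_ler_powR// ?nnegrE ?mulr_ge0// -natrM ler_nat.
by rewrite muln2 -addnn addSn addnS !ltnS leq_addl.
Qed.

End L1.

Definition hypercyclic (Y : topologicalType) (T : Y -> Y) (x : Y) : Prop :=
  dense [set iter n T x | n in [set n | (1 <= n)%N]].

(* A hypercyclic algebra need not contain the unit of the ambient algebra,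
   hence [subalg_closed], which requires it, is not used. *)
Definition common_hypercyclic_algebra (R : realType) (d : nat) (Lambda : Type)
    (T : Lambda -> l1_pow R d -> l1_pow R d) : Prop :=
  exists A : {pred l1_pow R d},
    [/\ submod_closed A, GRing.mulr_2closed A,
        exists2 x, x \in A & x != 0 &
        forall x, x \in A -> x != 0 -> forall l, hypercyclic (T l) x].

(* Main.v *)
Require Import Defs.
From mathcomp Require Import all_boot all_order all_algebra.
From mathcomp Require Import all_classical all_reals all_analysis.
From mathcomp Require Import complex ring lra zify.

(* Let [rho a n] be the product of the first [n] weights.  The algebra is the set
   of [P(x)], [P] a polynomial without constant term, for a single [x].  Dividing
   by the leading coefficient of [P], it suffices that for every degree [m], every
   finitely supported [v] in a countable dense set and every compact box of
   parameters, some iterate sends [x ^ m] close to [v] and [x ^ q] close to [0]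
   for all [q < m].
   Given a finitely supported [u], such an iterate is produced by perturbing [u]
   to [u + c X^sg + D], where [c] is small, [X^sg] lies beyond the support of [u],
   and [D] is a sum of small blocks [X^(n_f - (m-1) sg) W_f], one for each node
   [f] of a finite grid of parameters.  In the [m]-th power the term
   [m c^(m-1) X^((m-1) sg)] moves the block [f] to position [n_f], where the
   [n_f]-th iterate with the parameter of the node sends it exactly to [v]; in
   lower powers the block stays to the left of [n_f] and is killed.  Since
   [rho a n / rho b n] is at most about [n^|a - b|], blocks at positions about
   [2^t] tolerate an error of order [1/t] in the parameter, so a grid of
   polynomially many nodes in [t] suffices in any dimension [d], whereas the
   blocks have norm decaying exponentially in [t].  Hence all the cross terms are
   negligible for large [t], and the positions [n_f] can form an arithmetic
   progression.  *)

Set Implicit Arguments.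
Unset Strict Implicit.
Unset Printing Implicit Defensive.
Import Order.TTheory GRing.Theory Num.Theory.
Import numFieldNormedType.Exports.
Import Normc.
Local Open Scope classical_set_scope.
Local Open Scope ring_scope.

(** * Growth of the weight products *)

Section Weights.
Variable R : realType.
Implicit Types (a : {posnum R}) (w : {posnum R} -> nat -> R) (n i N t : nat).

Lemma bernoulli_le (x : R) n : 0 <= x -> 1 + n%:R * x <= (1 + x) ^+ n.
Proof.
move=> x0; elim: n => [|n IHn]; first by rewrite mul0r addr0.
rewrite exprS; apply: le_trans (_ : (1 + x) * (1 + n%:R * x) <= _); last first.
  by rewrite ler_wpM2l// addr_ge0.
have : 0 <= n%:R * x * x by rewrite !mulr_ge0.
rewrite -natr1; lra.
Qed.

Definition rho w a n : R := \prod_(1 <= k < n.+1) w a k.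

Lemma rho0 w a : rho w a 0 = 1.
Proof. by rewrite /rho big_geq. Qed.

Lemma rhoS w a n : rho w a n.+1 = rho w a n * w a n.+1.
Proof. by rewrite /rho big_nat_recr. Qed.

Lemma rho_gt0 w (hw : power_weights w \/ linear_weights w) a n : 0 < rho w a n.
Proof.
case: hw => wE; case: n => [|n]; rewrite ?rho0//.
  by rewrite /rho wE// powR_gt0.
rewrite /rho big_nat_cond; apply: prodr_gt0 => k /andP[/andP[k1 _] _].
by rewrite wE// ltr_wpDr// divr_ge0.
Qed.

(** For power weights the quotient is [((n + i) / i) ^ a]; the factor 2 pays for replacing [i] by
    [i + 1], which also makes sense at [i = 0]. For linear weights Bernoulli bounds each factor
    [1 + a / k] by [(1 + 1 / k) ^ N], and the product telescopes. *)
Lemma rho_le_ratio w (hw : power_weights w \/ linear_weights w) a N n i :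
  a%:num <= N%:R ->
  rho w a (n + i) <= (2 * (n + i).+1%:R / i.+1%:R) ^+ N * rho w a i.
Proof.
move=> aN; have r_gt0 := rho_gt0 hw a.
have ratio1 : 1 <= 2 * (n + i).+1%:R / i.+1%:R :> R.
  rewrite ler_pdivlMr ?ltr0n// mul1r -natrM ler_nat; lia.
case: hw => wE.
  have [->|i0] := posnP i.
    rewrite rho0 mulr1 addn0; have [->|n0] := posnP n.
      by rewrite rho0 exprn_ege1// mulr1 invr1 mulr1 ler1n.
    rewrite /rho wE// invr1 mulr1 -powR_mulrn ?mulr_ge0//.
    apply: le_trans (_ : n%:R `^ N%:R <= _).
      by rewrite ler_powR// ler1n.
    by rewrite ge0_ler_powR ?nnegrE ?mulr_ge0// -natrM ler_nat; lia.
  rewrite /rho !wE ?addn_gt0 ?i0 ?orbT//.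
  have i0' : 0 < i%:R :> R by rewrite ltr0n.
  rewrite -[(n + i)%:R](@divfK _ i%:R) ?gt_eqF// powRM ?divr_ge0// ler_wpM2r ?powR_ge0//.
  rewrite -powR_mulrn ?divr_ge0 ?mulr_ge0//.
  apply: le_trans (_ : ((n + i)%:R / i%:R) `^ N%:R <= _).
    by rewrite ler_powR// ler_pdivlMr// mul1r ler_nat leq_addl.
  rewrite ge0_ler_powR ?nnegrE ?divr_ge0 ?mulr_ge0//.
  rewrite ler_pdivrMr// mulrAC ler_pdivlMr ?ltr0n// -!natrM ler_nat; nia.
apply: le_trans (_ : ((n + i).+1%:R / i.+1%:R) ^+ N * rho w a i <= _); last first.
  apply: ler_wpM2r; first exact/ltW/r_gt0.
  rewrite lerXn2r ?nnegrE ?divr_ge0 ?mulr_ge0//.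
  by rewrite ler_wpM2r ?invr_ge0// ler_peMl// ler1n.
elim: n {ratio1} => [|n IHn].
  by rewrite divff ?pnatr_eq0// expr1n mul1r.
rewrite addSn rhoS.
have -> : (n + i).+2%:R / i.+1%:R =
  ((n + i).+1%:R / i.+1%:R) * (1 + 1 / (n + i).+1%:R) :> R.
  have k0 : (n + i).+1%:R != 0 :> R by rewrite pnatr_eq0.
  by rewrite -(natr1 (n + i).+1) [RHS]mulrAC mulrDr mulr1 mul1r divff.
rewrite exprMn mulrAC; apply: ler_pM => //; rewrite ?(ltW (r_gt0 _))//.
  by rewrite wE// addr_ge0// divr_ge0.
rewrite wE//; apply: le_trans (bernoulli_le N _) => //.
by rewrite lerD2l mul1r ler_wpM2r.
Qed.

(** In the linear case Bernoulli gives [(1 + a / k) ^ N >= 1 + 1 / k], and the product telescopes to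
    [n + 1]; the induction runs on this stronger bound. *)
Lemma rho_ge_root w (hw : power_weights w \/ linear_weights w) a N n :
  (0 < N)%N -> N%:R^-1 <= a%:num -> n%:R <= rho w a n ^+ N.
Proof.
move=> N0 Na; have {Na} Na : 1 <= a%:num * N%:R.
  by rewrite -ler_pdivrMr ?ltr0n// mul1r.
case: n => [|n]; first by rewrite exprn_ge0// ltW// rho_gt0.
case: hw => wE.
  rewrite /rho wE// -powR_mulrn ?powR_ge0// -powRrM.
  by rewrite -[leLHS](powRr1)// ler_powR// ler1n.
apply: le_trans (_ : n.+2%:R <= _); first by rewrite ler_nat.
elim: n.+1 => {n} [|n IHn]; first by rewrite rho0 expr1n.
rewrite rhoS exprMn.
have -> : n.+2%:R = n.+1%:R * (1 + 1 / n.+1%:R) :> R.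
  by rewrite -(natr1 n.+1) mulrDr mulr1 mul1r divff// pnatr_eq0.
apply: ler_pM => //; rewrite wE//.
apply: le_trans (bernoulli_le N _) => //.
by rewrite lerD2l mulrA ler_wpM2r// mulrC.
Qed.

Lemma ln_nat_le n t : (n <= 2 ^ t)%N -> ln n%:R <= t%:R :> R.
Proof.
(* [ln] takes the value 0 at 0. *)
case: n => [|n] nt; first by rewrite ln0.
rewrite -[leRHS]expRK ler_ln ?posrE ?expR_gt0//.
apply: le_trans (_ : 2%:R ^+ t <= _); first by rewrite -natrX ler_nat.
rewrite -[t%:R]mulr1 mulrC expRM_natr lerXn2r ?nnegrE ?expR_ge0//.
by have := @expR_ge1Dx R 1; rewrite -natr1.
Qed.

(** The logarithm of [rho w a n] has derivative in [a] equal to [ln n] for power weights, and at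
    most the harmonic sum, hence [1 + ln n], for linear ones. Both are at most [t + 1]. *)
Lemma rho_lipschitz w (hw : power_weights w \/ linear_weights w) a b n t :
  (n <= 2 ^ t)%N ->
  rho w a n <= expR (`|a%:num - b%:num| * t.+1%:R) * rho w b n.
Proof.
move=> nt; have r0 := ltW (rho_gt0 hw b _); have ra0 k := ltW (rho_gt0 hw a k).
case: n nt => [|n] nt.
  rewrite !rho0 mulr1; apply: le_trans (expR_ge1Dx _).
  by rewrite lerDl mulr_ge0.
have lnt := ln_nat_le nt.
case: hw => wE.
  rewrite /rho !wE// -[a%:num in leLHS](subrK b%:num) powRD; last first.
    by apply/implyP => _; rewrite pnatr_eq0.
  rewrite ler_wpM2r ?powR_ge0// /powR ifF ?pnatr_eq0// ler_expR.
  apply: le_trans (ler_norm _) _; rewrite normrM ler_wpM2l//.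
  rewrite ger0_norm ?ln_ge0 ?ler1n// (le_trans lnt)// ler_nat.
  exact: leqnSn.
apply: le_trans (_ : expR (`|a%:num - b%:num| * (1 + ln n.+1%:R)) * rho w b n.+1 <= _).
  elim: n {nt lnt} => [|n IHn].
    rewrite ln1 addr0 mulr1 !rhoS !rho0 !mul1r !wE// !divr1.
    have := ler_norm (a%:num - b%:num); have := expR_ge1Dx (`|a%:num - b%:num|).
    have : 0 <= (expR (`|a%:num - b%:num|) - 1) * b%:num.
      by rewrite mulr_ge0// subr_ge0 -expR0 ler_expR.
    lra.
  rewrite (rhoS w a) (rhoS w b).
  set k : R := n.+2%:R; have k0 : 0 < k by rewrite ltr0n.
  have step : w a n.+2 <= expR (`|a%:num - b%:num| / k) * w b n.+2.
    rewrite !wE// -/k; apply: le_trans (_ : 1 + b%:num / k + `|a%:num - b%:num| / k <= _).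
      rewrite -addrA -mulrDl lerD2l ler_wpM2r ?invr_ge0 ?(ltW k0)//.
      by rewrite -lerBlDl ler_norm.
    have := expR_ge1Dx (`|a%:num - b%:num| / k).
    have : 0 <= (expR (`|a%:num - b%:num| / k) - 1) * (b%:num / k).
      rewrite mulr_ge0 ?divr_ge0 ?(ltW k0)// subr_ge0 -expR0 ler_expR.
      by rewrite divr_ge0// ltW.
    move: (b%:num / k) (`|a%:num - b%:num| / k) => u v; lra.
  apply: le_trans (ler_pM _ _ IHn step) _.
  - exact: ra0.
  - by rewrite wE// addr_ge0// divr_ge0.
  rewrite mulrACA -expRD ler_wpM2r ?mulr_ge0 ?r0//.
    by rewrite wE// addr_ge0// divr_ge0.
  rewrite ler_expR -mulrDr ler_wpM2l// -addrA lerD2l.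
  rewrite -lerBrDl.
  have n1 : 0 < n.+1%:R :> R by rewrite ltr0n.
  have e : n.+1%:R = k * (1 + - k^-1) :> R.
    by rewrite mulrDr mulr1 mulrN divff ?gt_eqF// /k -(natr1 n.+1) addrK.
  (* The comparison of [1 / k] with an increment of [ln], from [ln (1 - 1 / k) <= - 1 / k]. *)
  have : ln n.+1%:R <= ln k - k^-1.
    have h : 0 < 1 + - k^-1 by rewrite -(pmulr_rgt0 _ k0) -e.
    by rewrite e lnM ?posrE// lerD2l le_ln1Dx// -subr_gt0 opprK addrC.
  by rewrite -/k; move: (ln k) (ln _) k^-1 => u v x; lra.
rewrite ler_wpM2r// ler_expR ler_wpM2l// -(natr1 t) addrC lerD2r//.
Qed.

End Weights.

(** * Weighted shifts on l1 *)

Section L1Theory.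
Variable R : realType.
Local Notation C := R[i].
Local Notation l1 := (l1 R).
Implicit Types (x y z : l1) (c : C) (n k p : nat).

(** The norm of the normed module takes values in [R[i]], whose order is only partial; estimates are
    made on this real version. *)
Definition nrm x : R := fine (l1_enorm x).

Lemma normr_nrm x : `|x| = (nrm x)%:C%C.
Proof. by []. Qed.

Lemma nrm_ge0 x : 0 <= nrm x.
Proof. by rewrite fine_ge0// l1_enorm_ge0. Qed.

Lemma nrm0 : nrm 0 = 0.
Proof. by have := normr0 l1; rewrite normr_nrm => -[]. Qed.

Lemma nrmD x y : nrm (x + y) <= nrm x + nrm y.
Proof. by have := ler_normD x y; rewrite !normr_nrm -rmorphD/= lecR. Qed.

Lemma nrm_sum (I : Type) (r : seq I) (P : pred I) (F : I -> l1) :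
  nrm (\sum_(i <- r | P i) F i) <= \sum_(i <- r | P i) nrm (F i).
Proof.
elim/big_ind2 : _ => [|x a y b xa yb|//]; first by rewrite nrm0.
by apply: le_trans (nrmD _ _) _; exact: lerD.
Qed.

Lemma nrmZ c x : nrm (c *: x) = normc c * nrm x.
Proof. by have := normrZ c x; rewrite !normr_nrm normc_normr -rmorphM => -[]. Qed.

Lemma enorm_nrm x : l1_enorm x = (nrm x)%:E.
Proof. by rewrite fineK// l1_fin. Qed.

Lemma nrmM x y : nrm (x * y) <= nrm x * nrm y.
Proof.
have := l1_enorm_conv x y.
by rewrite (enorm_nrm (x * y)) !enorm_nrm -EFinM lee_fin.
Qed.

Lemma nrm_ge_partial x n : \sum_(0 <= k < n) normc (x k) <= nrm x.
Proof. by rewrite -lee_fin -enorm_nrm l1_enorm_ge. Qed.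

Lemma nrm_le x (M : R) :
  (forall n, \sum_(0 <= k < n) normc (x k) <= M) -> nrm x <= M.
Proof.
move=> xM; rewrite -lee_fin -enorm_nrm; apply: l1_enorm_le => n.
by rewrite lee_fin.
Qed.

Lemma nrm_le_dilate x y (r : R) n : 0 <= r ->
  (forall i, normc (y i) <= r * normc (x (n + i)%N)) -> nrm y <= r * nrm x.
Proof.
move=> r0 yx; apply: nrm_le => m.
apply: le_trans (_ : r * \sum_(0 <= i < n + m) normc (x i) <= _); last first.
  by rewrite ler_wpM2l// nrm_ge_partial.
rewrite [X in _ * X](@big_cat_nat _ _ _ n)/= ?leq_addr// mulrDr.
rewrite -[leLHS]add0r lerD ?mulr_ge0 ?sumr_ge0// => [*|]; first exact: normc_ge0'.
have -> : \sum_(n <= i < n + m) normc (x i) = \sum_(0 <= i < m) normc (x (i + n)%N).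
  by rewrite -{1}[n]add0n big_addn addKn.
rewrite mulr_sumr; apply: ler_sum => i _.
by rewrite addnC.
Qed.

Lemma nrm_le_coef x y (r : R) : 0 <= r ->
  (forall i, normc (y i) <= r * normc (x i)) -> nrm y <= r * nrm x.
Proof. exact: (@nrm_le_dilate _ _ _ 0). Qed.

Lemma l1_ext x y : (x : nat -> C) =1 y -> x = y.
Proof. by move=> xy; apply/val_inj/funext. Qed.

Lemma l1_pred_bounded (f : nat -> C) (M : R) :
  (forall n, \sum_(0 <= k < n) normc (f k) <= M) -> f \in @l1_pred R.
Proof.
move=> fM; apply/l1_predP; apply: (@le_lt_trans _ _ M%:E); last exact: ltry.
by apply: l1_enorm_le => n; rewrite lee_fin.
Qed.

Definition cut_seq p (f : nat -> C) : nat -> C := fun k => if (k < p)%N then f k else 0.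

Lemma sum_cut p f n :
  \sum_(0 <= k < n) normc (cut_seq p f k) <= \sum_(0 <= k < p) normc (f k).
Proof.
apply: le_trans (_ : \sum_(0 <= k < p + n) normc (cut_seq p f k) <= _).
  rewrite addnC [leRHS](@big_cat_nat _ _ _ n) ?leq_addr//= lerDl sumr_ge0// => *.
  exact: normc_ge0'.
rewrite (@big_cat_nat _ _ _ p) ?leq_addr//= [X in _ + X]big1_seq => [|k].
  rewrite addr0 le_eqVlt; apply/orP; left; apply/eqP.
  rewrite big_nat_cond [RHS]big_nat_cond; apply: eq_bigr => k.
  by move=> /andP[/andP[_ kp] _]; rewrite /cut_seq kp.
by rewrite mem_index_iota => /andP[_ /andP[pk _]]; rewrite /cut_seq ltnNge pk normc0.
Qed.

(* Locked because [/=] would otherwise unfold the coefficients of [monom]. *)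
Definition l1_trunc p f : l1 := locked (L1 (l1_pred_bounded (sum_cut p f))).

Definition monom n : l1 := l1_trunc n.+1 (fun k => (k == n)%:R).

Lemma l1_truncE p f k : l1_trunc p f k = if (k < p)%N then f k else 0.
Proof. by rewrite /l1_trunc; unlock. Qed.

Lemma nrm_trunc p f : nrm (l1_trunc p f) <= \sum_(0 <= k < p) normc (f k).
Proof. by rewrite /l1_trunc; unlock; exact/nrm_le/sum_cut. Qed.

Lemma monomE n k : monom n k = (k == n)%:R.
Proof. by rewrite l1_truncE; case: ltnP => // nk; rewrite gtn_eqF. Qed.

Lemma l1_coefD x y k : (x + y) k = x k + y k. Proof. by []. Qed.
Lemma l1_coefN x k : (- x) k = - x k. Proof. by []. Qed.
Lemma l1_coefZ c x k : (c *: x) k = c * x k. Proof. by []. Qed.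
Lemma l1_coef0 k : (0 : l1) k = 0. Proof. by []. Qed.
Lemma l1_coefM x y k : (x * y) k = \sum_(j < k.+1) x j * y (k - j)%N. Proof. by []. Qed.
Lemma l1_coef1 k : (1 : l1) k = (k == 0)%:R. Proof. by []. Qed.

Lemma l1_coef_sum (I : Type) (r : seq I) (P : pred I) (F : I -> l1) k :
  (\sum_(i <- r | P i) F i) k = \sum_(i <- r | P i) F i k.
Proof. by elim/big_rec2 : _ => // i c x _ <-. Qed.

Lemma monomM n x k : (monom n * x) k = if (k < n)%N then 0 else x (k - n)%N.
Proof.
rewrite l1_coefM; case: ltnP => kn.
  rewrite big1 // => j _; rewrite monomE ltn_eqF ?mul0r//.
  by apply: leq_ltn_trans kn; rewrite -ltnS.
have nk : (n < k.+1)%N by [].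
rewrite (bigD1 (Ordinal nk))//= monomE eqxx mul1r big1 ?addr0// => j jn.
rewrite monomE; case: eqP => [e|_]; last by rewrite mul0r.
by case/eqP: jn; apply: val_inj.
Qed.

Lemma monom0 : monom 0 = 1.
Proof. by apply: l1_ext => k; rewrite monomE l1_coef1. Qed.

Lemma monomD n p : monom n * monom p = monom (n + p).
Proof.
apply: l1_ext => k; rewrite monomM !monomE; case: ltnP => kn.
  by rewrite ltn_eqF// (leq_trans kn)// leq_addr.
by rewrite -(eqn_add2r n) subnK// addnC.
Qed.

Lemma nrm_monom n : nrm (monom n) <= 1.
Proof.
apply: le_trans (nrm_trunc _ _) _.
rewrite big_nat_recr//= eqxx (normc1 R) big_nat_cond big1 ?add0r//.
by move=> k /andP[/andP[_ kn] _]; rewrite ltn_eqF// normc0.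
Qed.

(** In terms of power series, [lo x a] means that [X^a] divides [x], and [hi x a] that [x] is a
    polynomial of degree less than [a]. *)
Definition lo x a := forall k, (k < a)%N -> x k = 0.
Definition hi x a := forall k, (a <= k)%N -> x k = 0.

Lemma loM x y a b : lo x a -> lo y b -> lo (x * y) (a + b).
Proof.
move=> xa yb k kab; rewrite l1_coefM big1// => j _.
have [ja|aj] := ltnP j a; first by rewrite xa ?mul0r.
by rewrite yb ?mulr0//; have := ltn_ord j; lia.
Qed.

Lemma hiM x y a b : hi x a.+1 -> hi y b.+1 -> hi (x * y) (a + b).+1.
Proof.
move=> xa yb k kab; rewrite l1_coefM big1// => j _.
have [ja|aj] := leqP j a; last by rewrite xa ?mul0r.
by rewrite yb ?mulr0//; have := ltn_ord j; lia.
Qed.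

Lemma loW x a b : (b <= a)%N -> lo x a -> lo x b.
Proof. by move=> ba xa k kb; apply: xa; exact: leq_trans ba. Qed.

Lemma hiW x a b : (a <= b)%N -> hi x a -> hi x b.
Proof. by move=> ab xa k bk; apply: xa; exact: leq_trans bk. Qed.

Lemma hiD x y a : hi x a -> hi y a -> hi (x + y) a.
Proof. by move=> xa ya k ak; rewrite l1_coefD xa// ya// addr0. Qed.

Lemma hiZ c x a : hi x a -> hi (c *: x) a.
Proof. by move=> xa k ak; rewrite l1_coefZ xa// mulr0. Qed.

Lemma hi_sum (I : Type) (r : seq I) (P : pred I) (F : I -> l1) a :
  (forall i, P i -> hi (F i) a) -> hi (\sum_(i <- r | P i) F i) a.
Proof. by move=> Fa k ak; rewrite l1_coef_sum big1// => i Pi; exact: Fa. Qed.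

Lemma lo_sum (I : Type) (r : seq I) (P : pred I) (F : I -> l1) a :
  (forall i, P i -> lo (F i) a) -> lo (\sum_(i <- r | P i) F i) a.
Proof. by move=> Fa k ak; rewrite l1_coef_sum big1// => i Pi; exact: Fa. Qed.

Lemma hi_monom n : hi (monom n) n.+1.
Proof. by move=> k nk; rewrite monomE gtn_eqF. Qed.

Lemma lo_monom n : lo (monom n) n.
Proof. by move=> k nk; rewrite monomE ltn_eqF. Qed.

Lemma hi_trunc p f : hi (l1_trunc p f) p.
Proof. by move=> k pk; rewrite l1_truncE ltnNge pk. Qed.

Lemma hiX x a n : hi x a.+1 -> hi (x ^+ n) (n * a).+1.
Proof.
move=> xa; elim: n => [|n IHn]; first by rewrite expr0 -monom0; exact: hi_monom.
by rewrite exprS mulSn; exact: hiM.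
Qed.

Lemma loMr x y a : lo x a -> lo (x * y) a.
Proof. by move=> xa; rewrite -[a]addn0; exact: loM. Qed.

Lemma nrmX x n : nrm (x ^+ n) <= nrm x ^+ n.
Proof.
elim: n => [|n IHn]; first by rewrite !expr0 -monom0 nrm_monom.
rewrite !exprS; apply: le_trans (nrmM _ _) _.
by rewrite ler_wpM2l ?nrm_ge0.
Qed.

(** * Iterates of one weighted shift *)

Section Shift.
Variables (w : {posnum R} -> nat -> R) (hw : power_weights w \/ linear_weights w).
Variable a : {posnum R}.
Let S n x := iter n (wshift (weights_bounded hw a)) x.

Lemma normc_real (r : R) : normc (r%:C%C) = `|r|.
Proof. by rewrite /normc/= expr0n/= addr0 sqrtr_sqr. Qed.

(** The factor is the product of the weights from [i + 1] to [i + n], written as a quotient so that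
    the growth of [rho] applies. *)
Lemma shiftE n x i :
  S n x i = (rho w a (n + i) / rho w a i)%:C%C * x (n + i)%N.
Proof.
have r0 k : rho w a k != 0 by rewrite gt_eqF// rho_gt0.
elim: n i => [|n IHn] i; first by rewrite divff// mul1r.
rewrite /S iterS [LHS]/= -/(S n x) IHn mulrA -rmorphM/= addSnnS.
congr (_%:C%C * _); have := rhoS w a i; have := r0 i; have := r0 i.+1.
move: (rho w a i.+1) (rho w a i) (w a i.+1) (rho w a _) => u v c A u0 v0 e.
move: u0; rewrite e mulf_eq0 negb_or => /andP[_ c0].
by field; rewrite v0.
Qed.

Lemma shiftD n x y : S n (x + y) = S n x + S n y.
Proof. by apply: l1_ext => k; rewrite l1_coefD !shiftE l1_coefD mulrDr. Qed.

Lemma shiftN n x : S n (- x) = - S n x.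
Proof. by apply: l1_ext => k; rewrite l1_coefN !shiftE l1_coefN mulrN. Qed.

Lemma shiftB n x y : S n (x - y) = S n x - S n y.
Proof. by rewrite shiftD shiftN. Qed.

Lemma shiftZ n c x : S n (c *: x) = c *: S n x.
Proof. by apply: l1_ext => k; rewrite l1_coefZ !shiftE l1_coefZ mulrCA. Qed.

Lemma shift_sum n (I : Type) (r : seq I) (P : pred I) (F : I -> l1) :
  S n (\sum_(i <- r | P i) F i) = \sum_(i <- r | P i) S n (F i).
Proof.
apply: l1_ext => k; rewrite l1_coef_sum shiftE l1_coef_sum mulr_sumr.
by apply: eq_bigr => i _; rewrite shiftE.
Qed.

Lemma shift_hi n x : hi x n -> S n x = 0.
Proof.
move=> xn; apply: l1_ext => k.
by rewrite shiftE xn ?mulr0// leq_addr.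
Qed.

(** Only the indices [i] with [n <= kap * (i + 1)] contribute, and there the ratio
    [(n + i + 1) / (i + 1)] is at most [kap + 1]. A vector vanishing just after position [n] is thus
    enlarged by a factor independent of [n]. *)
Lemma nrm_shift N kap n x : a%:num <= N%:R ->
  (forall i, (kap * i.+1 < n)%N -> x (n + i)%N = 0) ->
  nrm (S n x) <= (2 * kap.+1%:R) ^+ N * nrm x.
Proof.
move=> aN xn; apply: (@nrm_le_dilate _ _ _ n) => [|i].
  by rewrite exprn_ge0// mulr_ge0.
rewrite shiftE normcM normc_real.
have [/xn ->|ni] := ltnP (kap * i.+1) n; first by rewrite !normc0 !mulr0.
rewrite ler_wpM2r ?normc_ge0'// ger0_norm ?divr_ge0 ?(ltW (rho_gt0 hw a _))//.
rewrite ler_pdivrMr ?rho_gt0//; apply: le_trans (rho_le_ratio hw _ _ aN) _.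
rewrite ler_wpM2r ?(ltW (rho_gt0 hw a _))// lerXn2r ?nnegrE ?divr_ge0 ?mulr_ge0//.
by rewrite -mulrA ler_wpM2l// ler_pdivrMr ?ltr0n// -natrM ler_nat; lia.
Qed.

Lemma nrm_shift_any N n x : a%:num <= N%:R ->
  nrm (S n x) <= (2 * n.+1%:R) ^+ N * nrm x.
Proof. by move=> aN; apply: nrm_shift => // i; rewrite ltnNge leq_pmulr. Qed.

End Shift.
End L1Theory.

(** * Powers of a perturbed vector *)

Section BlockEstimate.
Variable R : realType.
Local Notation C := R[i].
Local Notation l1 := (l1 R).
Implicit Types (x y z a D E u : l1) (c : C) (n k p q s m N : nat).

(** One worse than [hiM], but valid for empty supports too. *)
Lemma hiM_weak x y i j : hi x i -> hi y j -> hi (x * y) (i + j).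
Proof.
move=> xi yj k kij; rewrite l1_coefM big1// => l _.
have [il|li] := leqP i l; first by rewrite xi ?mul0r.
by rewrite yj ?mulr0//; lia.
Qed.

Lemma hi_eq0 x : hi x 0 -> x = 0.
Proof. by move=> x0; apply: l1_ext => k; rewrite x0. Qed.

Lemma l1_coefMn x n k : (x *+ n) k = x k *+ n.
Proof. by elim: n => // n IHn; rewrite !mulrS l1_coefD IHn. Qed.

Lemma hiMn x n k : hi x k -> hi (x *+ n) k.
Proof. by move=> xk j kj; rewrite l1_coefMn xk// mul0rn. Qed.

Lemma nrmMn x n : nrm (x *+ n) <= nrm x *+ n.
Proof.
elim: n => [|n IHn]; first by rewrite nrm0.
by rewrite !mulrS; apply: le_trans (nrmD _ _) _; rewrite lerD2l.
Qed.

(** Every term of the expansion except the top one uses [u] at least once in place of [X^sg], which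
    lowers the degree by more than [sg - p]. *)
Lemma hi_pow_lead u c p sg k : (p <= sg)%N -> hi u p ->
  hi ((u + c *: monom R sg) ^+ k - c ^+ k *: monom R (k * sg)) (k * sg - (sg - p)).
Proof.
move=> psg up; elim: k => [|k IHk].
  by rewrite expr0 scale1r mul0n monom0 subrr => k.
set E := _ - _ in IHk *.
have defE : (u + c *: monom R sg) ^+ k = c ^+ k *: monom R (k * sg) + E.
  by rewrite /E [RHS]addrC subrK.
clearbody E.
have -> : (u + c *: monom R sg) ^+ k.+1 - c ^+ k.+1 *: monom R (k.+1 * sg) =
   u * (c ^+ k *: monom R (k * sg)) + u * E + c *: (monom R sg * E).
  rewrite mulSn -monomD exprS defE.
  have e : (c *: monom R sg) * (c ^+ k *: monom R (k * sg)) =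
      c ^+ k.+1 *: (monom R sg * monom R (k * sg)).
    by rewrite -scalerAl -scalerAr scalerA exprS.
  rewrite mulrDl !mulrDr e. rewrite -(scalerAl c _ E).
  by rewrite [X in _ + X - _]addrC addrA addrK.
apply: hiD; first apply: hiD.
- rewrite -scalerAr; apply: hiZ => i ki; rewrite mulrC monomM.
  by case: ltnP => // ksi; rewrite up//; nia.
- have [k0|k0] := posnP k; first by rewrite (@hi_eq0 E) ?mulr0//; move: IHk; rewrite k0 mul0n.
  apply: hiW (hiM_weak up IHk).
  have : (sg <= k * sg)%N by rewrite leq_pmull.
  by rewrite mulSn; lia.
- apply: hiZ => i ki; rewrite monomM; case: ltnP => // si; rewrite IHk//.
  by move: ki; rewrite mulSn; lia.
Qed.

(** The remainders obey [S_(q+1) = (a + D) S_q + q a^(q-1)], and [q^2 + q <= (q + 1)^2] closes the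
    induction on the bound. *)
Lemma pow_taylor a D (A : R) q : 1 <= A -> nrm a <= A -> nrm (a + D) <= A ->
  exists2 S, (a + D) ^+ q = a ^+ q + (a ^+ q.-1 *+ q) * D + D * D * S &
    nrm S <= q%:R ^+ 2 * A ^+ q.
Proof.
move=> A1 aA aDA; have A0 : 0 <= A by exact: le_trans A1.
elim: q => [|q [S IHS Sq]].
  by exists 0; rewrite ?nrm0 ?mulr_ge0 ?exprn_ge0// mulr0n mul0r mulr0 !addr0.
exists ((a + D) * S + a ^+ q.-1 *+ q).
  rewrite exprS IHS /= [a ^+ q.+1]exprS.
  have -> : a ^+ q *+ q.+1 = a ^+ q + a * (a ^+ q.-1 *+ q).
    rewrite mulrS; congr (_ + _).
    by case: q {IHS Sq} => [|q]; rewrite ?mulr0n ?mulr0// mulrnAr -exprS.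
  ring.
apply: le_trans (nrmD _ _) _.
apply: le_trans (lerD (nrmM _ _) (nrmMn _ _)) _.
have s1 : nrm (a + D) * nrm S <= A * (q%:R ^+ 2 * A ^+ q).
  by apply: ler_pM; rewrite ?nrm_ge0.
have s2 : nrm (a ^+ q.-1) *+ q <= q%:R * A ^+ q.+1.
  rewrite -[leLHS]mulr_natl ler_wpM2l//; apply: le_trans (nrmX _ _) _.
  apply: le_trans (_ : A ^+ q.-1 <= _); first by rewrite lerXn2r ?nnegrE ?nrm_ge0.
  by rewrite ler_weXn2l//; lia.
apply: le_trans (lerD s1 s2) _; rewrite mulrCA -exprS -mulrDl ler_wpM2r ?exprn_ge0//.
by rewrite -natr1; have := ler0n R q; nra.
Qed.

Variables (w : {posnum R} -> nat -> R) (hw : power_weights w \/ linear_weights w).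
Variables (F : finType) (nn : F -> nat) (W : F -> l1).
Variables (m p sg s Q : nat) (u : l1) (c : C) (A : R).
Hypotheses (m0 : (0 < m)%N) (p0 : (0 < p)%N) (psg : (2 * p < sg)%N).
Hypotheses (Q0 : (0 < Q)%N) (ms : (8 * m * sg <= s)%N).
(** All positions lie in [[2Qs, 3Qs]], so a product of two blocks starts near [4Qs] or later, well
    beyond every position. *)
Hypothesis nn_bnd : forall f, (2 * Q * s <= nn f <= 3 * Q * s)%N.
Hypothesis nn_gap : forall f g, (nn f < nn g)%N -> (nn f + s <= nn g)%N.
Hypothesis nn_inj : injective nn.
Hypotheses (up : hi u p) (Wp : forall f, hi (W f) p).
Let a := u + c *: monom R sg.
Let DD f := monom R (nn f - m.-1 * sg) * W f.
Let D := \sum_f DD f.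
Let eta := \sum_f nrm (W f).
Hypotheses (A1 : 1 <= A) (aA : nrm a + 1 <= A) (eta1 : eta <= 1).

Lemma nrm_block f : nrm (DD f) <= nrm (W f).
Proof.
apply: le_trans (nrmM _ _) _.
by rewrite -[leRHS]mul1r ler_wpM2r ?nrm_ge0 ?nrm_monom.
Qed.

Lemma nrm_blocks (P : pred F) : nrm (\sum_(f | P f) DD f) <= eta.
Proof.
apply: le_trans (nrm_sum _ _ _) _; apply: le_trans (_ : \sum_(f | P f) nrm (W f) <= _).
  by apply: ler_sum => f _; exact: nrm_block.
by rewrite /eta [leRHS](bigID P)/= lerDl sumr_ge0// => *; exact: nrm_ge0.
Qed.

Lemma nn_ge f : (2 * s <= nn f)%N.
Proof. by have /andP[h _] := nn_bnd f; apply: leq_trans h; nia. Qed.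

Lemma block_lo f : lo (DD f) (nn f - m.-1 * sg).
Proof. exact/loMr/lo_monom. Qed.

Lemma block_hi f : hi (DD f) (nn f - m.-1 * sg + p).
Proof.
case: p p0 Wp => // r _ Wr; rewrite addnS; apply: hiM => //.
exact: hi_monom.
Qed.

Lemma base_hi : hi a sg.+1.
Proof.
apply: hiD; last exact/hiZ/hi_monom.
by apply: hiW up; lia.
Qed.

(* Taylor expansion of [(a + D) ^+ q] around [a]: the shift by [nn f] kills
   [a ^+ q], the blocks before [f], and the products of [DD f] with everything in
   [a ^+ q.-1 *+ q] except the top monomial of [a ^+ m.-1]; the later blocks and
   the part of order two in [D] start far to the right of [nn f], where the
   weights grow at most polynomially in [Q]. *)
Lemma block_estimate (l : {posnum R}) N q f : l%:num <= N%:R -> (0 < q <= m)%N ->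
  nrm (iter (nn f) (wshift (weights_bounded hw l)) ((a + D) ^+ q) -
       (q == m)%:R *: iter (nn f) (wshift (weights_bounded hw l))
           (m%:R * c ^+ m.-1 *: (monom R (m.-1 * sg) * DD f)))
  <= (2 * (6 * Q).+1%:R) ^+ N * (2 * m%:R ^+ 2 * A ^+ m * eta).
Proof.
move=> lN /andP[q0 qm].
have A0 : 0 <= A by exact: le_trans A1.
have eta0 : 0 <= eta by rewrite sumr_ge0// => *; exact: nrm_ge0.
have aDA : nrm (a + D) <= A.
  apply: le_trans (nrmD _ _) _; apply: le_trans aA; rewrite lerD2l.
  exact: le_trans (nrm_blocks _) eta1.
have [S eS nS] : exists2 S, (a + D) ^+ q = a ^+ q + (a ^+ q.-1 *+ q) * D + D * D * S &
    nrm S <= q%:R ^+ 2 * A ^+ q.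
  by apply: pow_taylor => //; apply: le_trans aA; rewrite lerDl.
set T := a ^+ q.-1 *+ q in eS.
(* [L] is the only part of [T] that carries the block [f] up to position [nn f]; it is zero unless
   [q = m]. *)
set L := (q == m)%:R *: (m%:R * c ^+ m.-1 *: monom R (m.-1 * sg)).
have TL : hi (T - L) (m.-1 * sg - (sg - p)).
  rewrite /L /T; have [->|qm'] := eqVneq q m.
    rewrite scale1r -scalerA scaler_nat -mulrnBl.
    by apply/hiMn/hi_pow_lead => //; lia.
  rewrite scale0r subr0; apply: hiW (hiMn _ (hiX base_hi)).
  have : (q.-1 * sg + sg <= m.-1 * sg)%N by rewrite -mulSnr leq_mul2r; lia.
  lia.
have Th : hi T (q.-1 * sg).+1.
  by apply: hiMn; apply: hiX; exact: base_hi.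
(* [H] is supported to the left of [nn f] and is killed by the iterate; [G] is the remainder to be
   estimated. *)
pose G := T * (\sum_(g | (nn f < nn g)%N) DD g) + D * D * S.
pose H := a ^+ q + T * (\sum_(g | (nn g < nn f)%N) DD g) + (T - L) * DD f.
have eG : (a + D) ^+ q = H + L * DD f + G.
  have eD : D = \sum_(g | (nn f < nn g)%N) DD g + DD f + \sum_(g | (nn g < nn f)%N) DD g.
    rewrite /D (bigID (fun g => (nn f < nn g)%N))/= -addrA; congr (_ + _).
    rewrite (bigD1 f) ?ltnn//=; congr (_ + _); apply: eq_bigl => g.
    by rewrite -leqNgt andbC ltn_neqAle; congr (_ && _); rewrite (inj_eq nn_inj).
  rewrite eS {1}eD /H /G; ring.
have Hf : hi H (nn f).
  have := nn_ge f => nf.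
  have qm1 : (q.-1 * sg <= m.-1 * sg)%N by rewrite leq_mul2r; lia.
  have mE : (m * sg = m.-1 * sg + sg)%N by rewrite -mulSnr prednK.
  have qE : (q * sg = q.-1 * sg + sg)%N by rewrite -mulSnr prednK.
  apply: hiD; first apply: hiD.
  - by apply: hiW (hiX base_hi); lia.
  - rewrite mulr_sumr; apply: hi_sum => g /nn_gap gf.
    apply: hiW (hiM_weak Th (@block_hi g)); have := nn_ge g; lia.
  (* For [m = 1] the truncated bound in [TL] is 0, so [T - L] vanishes. *)
  have [m1|m1] := leqP m 1.
    rewrite (@hi_eq0 (T - L)); first by rewrite mul0r.
    by apply: hiW TL; rewrite (_ : m.-1 = 0)%N ?mul0n// ; lia.
  apply: hiW (hiM_weak TL (@block_hi f)).
  have : (sg <= m.-1 * sg)%N by rewrite leq_pmull; lia.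
  lia.
have -> : (q == m)%:R *: iter (nn f) (wshift (weights_bounded hw l))
           (m%:R * c ^+ m.-1 *: (monom R (m.-1 * sg) * DD f)) =
   iter (nn f) (wshift (weights_bounded hw l)) (L * DD f).
  by rewrite -shiftZ /L -!scalerAl.
rewrite -shiftB eG addrAC addrK shiftD (shift_hi _ _ Hf) add0r.
(* If [6Q(i + 1) < nn f <= 3Qs], then [2(i + 1) < s], whereas both terms of [G] start at least
   [3s/4] after [nn f]. *)
apply: le_trans (@nrm_shift _ _ hw l N (6 * Q) _ G lN _) _.
  move=> i iQ; have /andP[_ nf] := nn_bnd f.
  have is2 : (2 * i.+1 < s)%N by nia.
  have mE : (m * sg = m.-1 * sg + sg)%N by rewrite -mulSnr prednK.
  have Qs : (s <= Q * s)%N by rewrite leq_pmull.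
  have lo1 : lo (T * (\sum_(g | (nn f < nn g)%N) DD g)) (nn f + s - m * sg).
    rewrite mulrC; apply: loMr; apply: lo_sum => g /nn_gap fg.
    by apply: loW (@block_lo g); lia.
  have D_lo : lo D (2 * Q * s - m * sg).
    apply: lo_sum => g _; apply: loW (@block_lo g).
    by have /andP[+ _] := nn_bnd g; lia.
  have lo2 := loMr S (loM D_lo D_lo).
  by rewrite l1_coefD lo1 ?lo2 ?addr0//; lia.
rewrite ler_wpM2l ?exprn_ge0 ?mulr_ge0//.
apply: le_trans (nrmD _ _) _.
have n1 : nrm (T * \sum_(g | (nn f < nn g)%N) DD g) <= m%:R ^+ 2 * A ^+ m * eta.
  apply: le_trans (nrmM _ _) _; apply: ler_pM; rewrite ?nrm_ge0 ?nrm_blocks//.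
  apply: le_trans (nrmMn _ _) _; rewrite -[leLHS]mulr_natl.
  apply: ler_pM; rewrite ?nrm_ge0//.
    by rewrite -natrX ler_nat; nia.
  apply: le_trans (nrmX _ _) _; apply: le_trans (_ : A ^+ q.-1 <= _).
    by rewrite lerXn2r ?nnegrE ?nrm_ge0//; apply: le_trans aA; rewrite lerDl.
  by rewrite ler_weXn2l//; lia.
have n2 : nrm (D * D * S) <= m%:R ^+ 2 * A ^+ m * eta.
  apply: le_trans (nrmM _ _) _; rewrite [leRHS]mulrC.
  apply: ler_pM; rewrite ?nrm_ge0//.
    apply: le_trans (nrmM _ _) _; rewrite -[leRHS]mulr1.
    by apply: ler_pM; rewrite ?nrm_ge0 ?nrm_blocks// (le_trans (nrm_blocks _)).
  apply: le_trans nS _; apply: ler_pM; rewrite ?exprn_ge0//.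
    by rewrite lerXn2r ?nnegrE// ler_nat.
  by rewrite ler_weXn2l.
lra.
Qed.

End BlockEstimate.

(** * One step of the construction *)

Section Perturbation.
Variable R : realType.
Local Notation C := R[i].
Local Notation l1 := (l1 R).
Variables (w : {posnum R} -> nat -> R) (hw : power_weights w \/ linear_weights w).
Implicit Types (l mu : {posnum R}).

Lemma poly_le_exp2 K B : exists2 t, (0 < t)%N & (K * t ^ B <= 2 ^ t)%N.
Proof.
(* Taking [t] a power of two reduces the claim to the exponents: [K + (2z + 1)B <= 2 * (2^z)^2],
   which follows from [z < 2^z]. *)
pose z := (K + B)%N; exists (2 ^ (2 * z).+1)%N; first by rewrite expn_gt0.
rewrite -expnM; apply: (@leq_trans (2 ^ (K + (2 * z).+1 * B))).
  by rewrite expnD leq_mul2r ltnW ?orbT// ltn_expl.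
rewrite leq_exp2l// expnS mulnC expnM mulnC -[(2 ^ 2)%N]/(2 * 2)%N expnMn.
have := @ltn_expl 2 z isT; rewrite /z; nia.
Qed.

(** The quantity lies between [(1 + om)^-2] and [(1 + om)^2], and [2 om + om^2 <= 3 om] because
    [om <= 1]. *)
Lemma ratio_near1 (om x y x' y' : R) : 0 < x -> 0 < y -> 0 < x' -> 0 < y' ->
  0 <= om <= 1 -> x <= (1 + om) * x' -> x' <= (1 + om) * x ->
  y <= (1 + om) * y' -> y' <= (1 + om) * y ->
  `|x / y * (y' / x') - 1| <= 3 * om.
Proof.
move=> x0 y0 x'0 y'0 /andP[om0 om1] xx' x'x yy' y'y.
have -> : x / y * (y' / x') = (x / x') * (y' / y) by field; rewrite !gt_eqF.
have a1 : x / x' <= 1 + om by rewrite ler_pdivrMr.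
have a2 : y' / y <= 1 + om by rewrite ler_pdivrMr.
have b1 : 1 <= (1 + om) * (x / x') by rewrite mulrA ler_pdivlMr// mul1r.
have b2 : 1 <= (1 + om) * (y' / y) by rewrite mulrA ler_pdivlMr// mul1r.
move: (divr_gt0 x0 x'0) (divr_gt0 y'0 y0) a1 a2 b1 b2.
move: (x / x') (y' / y) => a b a0 b0 a1 a2 b1 b2.
have abu : a * b <= (1 + om) * (1 + om) by apply: ler_pM => //; exact: ltW.
have abl : 1 <= (1 + om) * (1 + om) * (a * b).
  by rewrite mulrACA -[leLHS]mulr1; apply: ler_pM.
have ab0 : 0 < a * b by rewrite mulr_gt0.
move: (a * b) abu abl ab0 => r {a0 b0 a1 a2 b1 b2} ru rl r0.
rewrite ler_norml; apply/andP; split; last nra.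
have [r1|r1] := leP r 1; nra.
Qed.

Section Target.
Variables (v : l1) (p k n : nat) (b om : R) (l mu : {posnum R}).
Hypotheses (vp : hi v p) (b0 : 0 < b) (kn : (k <= n)%N) (om01 : 0 <= om <= 1).
Hypothesis close : forall j, (j <= n + p)%N ->
  rho w l j <= (1 + om) * rho w mu j /\ rho w mu j <= (1 + om) * rho w l j.
Let W := l1_trunc p (fun j => (rho w mu j / (b * rho w mu (n + j)))%:C%C * v j).

(* The coefficients of [W] invert the shift with parameter [mu] exactly, so the
   shift with a nearby parameter [l] almost reproduces [v]. *)
Lemma shift_target :
  nrm (iter n (wshift (weights_bounded hw l))
        (b%:C%C *: (monom R k * (monom R (n - k) * W))) - v) <= 3 * om * nrm v.
Proof.
have /andP[om0 _] := om01.
apply: nrm_le_coef => [|j]; first by rewrite mulr_ge0.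
rewrite l1_coefD l1_coefN shiftE l1_coefZ [monom R k * _]mulrA monomD.
rewrite subnKC// monomM ltnNge leq_addr/=.
rewrite addKn l1_truncE; case: ltnP => [jp|pj]; last first.
  by rewrite vp// !mulr0 subr0 normc0 mulr0.
have [r1 r2] := close (leq_add (leqnn n) (ltnW jp)).
have [r3 r4] := close (leq_trans (ltnW jp) (leq_addl n p)).
rewrite !mulrA -!rmorphM/= -{2}[v j]mul1r -mulrBl normcM.
rewrite -[1]/(1%:C%C) -rmorphB normc_real ler_wpM2r ?normc_ge0'//.
have -> : rho w l (n + j) / rho w l j * b * (rho w mu j / (b * rho w mu (n + j)))
   = rho w l (n + j) / rho w l j * (rho w mu j / rho w mu (n + j)).
  by field; rewrite !gt_eqF// rho_gt0.
by apply: ratio_near1 => //; rewrite rho_gt0.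
Qed.

(** In each coefficient of [W] the numerator is at most [(2p)^N], while [rho] at [n + j] is at least
    the [N]-th root of [n], hence at least [y]. *)
Lemma nrm_target N (y : R) : mu%:num <= N%:R -> (0 < N)%N -> N%:R^-1 <= mu%:num ->
  0 < y -> y ^+ N <= n%:R ->
  nrm W <= (2 * p%:R) ^+ N / b / y * nrm v.
Proof.
move=> muN N0 Nmu y0 yn.
apply: nrm_le_coef => [|j]; first by rewrite !divr_ge0 ?exprn_ge0 ?mulr_ge0 ?(ltW b0) ?(ltW y0).
have r0 i : 0 < rho w mu i by rewrite rho_gt0.
rewrite l1_truncE; case: ltnP => [jp|pj]; last by rewrite vp// normc0 mulr0.
rewrite normcM normc_real ler_wpM2r ?normc_ge0'// ger0_norm; last first.
  by rewrite divr_ge0 ?mulr_ge0 ?ltW.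
rewrite -mulrA -invfM; apply: ler_pM; rewrite ?invr_ge0 ?mulr_ge0 ?(ltW (r0 _)) ?(ltW b0) ?(ltW y0)//.
  have := rho_le_ratio hw j 0 muN; rewrite addn0 divr1 rho0 mulr1 => h.
  apply: le_trans h _; rewrite lerXn2r ?nnegrE ?mulr_ge0// ler_wpM2l// ler_nat//.
rewrite lef_pV2 ?posrE ?mulr_gt0// ler_wpM2l ?(ltW (r0 _)) ?(ltW b0) ?(ltW y0)//.
rewrite -(ler_pXn2r N0) ?nnegrE ?(ltW (r0 _)) ?(ltW b0) ?(ltW y0)//; apply: le_trans yn _.
apply: le_trans (_ : (n + j)%:R <= _); first by rewrite ler_nat leq_addr.
exact: rho_ge_root.
Qed.

End Target.

End Perturbation.

(** * Assembling the blocks over a grid of parameters *)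

Section KeyStep.
Variable R : realType.
Local Notation C := R[i].
Local Notation l1 := (l1 R).
Variables (w : {posnum R} -> nat -> R) (hw : power_weights w \/ linear_weights w).

Lemma nat_ge (r : R) : exists n : nat, r <= n%:R.
Proof. by exists (Num.truncn r).+1; exact/ltW/truncnS_gt. Qed.

(* The number [Q] of parameters needed for blocks at positions about [2 ^ t] is
   polynomial in [t], because [rho] is Lipschitz in the parameter with a constant
   linear in [t]: this is what makes a [d]-dimensional family tractable. *)
Lemma scale_choice (d m sg N K1 C0 : nat) : exists t s : nat,
  [/\ (0 < t)%N, s = (2 ^ t)%N & let Q := ((C0.+1 * t) ^ d)%N in
    [/\ (8 * m * sg <= s)%N, (4 * Q <= s)%N &
        (K1%:R * Q%:R ^+ N.+1) ^+ N <= s%:R :> R]].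
Proof.
(* The coefficient sums the constants of the three requirements; the exponent dominates the powers
   [d] and [d(N + 1)N] of [t] occurring in them. *)
have [t t0 ht] := poly_le_exp2
  (8 * m * sg + 4 * C0.+1 ^ d + (K1 * (C0.+1 ^ d) ^ N.+1) ^ N) (d * N.+1 * N.+1).
have tN k : (t ^ k <= t ^ (k * N.+1))%N by rewrite leq_pexp2l// leq_pmulr.
have T1 : (0 < t ^ (d * N.+1 * N.+1))%N by rewrite expn_gt0 t0.
exists t, (2 ^ t)%N; split=> //; rewrite expnMn; split.
- apply: leq_trans ht; rewrite -addnA mulnDl.
  by apply: leq_trans (leq_addr _ _); rewrite leq_pmulr.
- apply: leq_trans ht; rewrite mulnA; apply: leq_mul.
    by rewrite addnAC leq_addl.
  exact: leq_trans (tN _) (tN _).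
rewrite -!natrX -natrM -natrX ler_nat; apply: leq_trans ht.
rewrite [((_ * t ^ d) ^ _)%N]expnMn mulnA [((_ * _) ^ N)%N]expnMn -!expnM.
apply: leq_mul; first exact: leq_addl.
by rewrite leq_pexp2l// -mulnA leq_mul2l leq_mul2l leqnSn !orbT.
Qed.

(* The bound is [N.-1] so that a grid of [(0, +oo)^d] covering the box stays
   below [N], see [mu] in the next proof. *)
Definition in_box N (l : {posnum R}) := N%:R^-1 <= l%:num <= N.-1%:R.

(** Keeping the first [p] coefficients allows a coefficientwise limit over the stages; the bound [M]
    on the iterates, uniform in the parameters, makes the conclusion stable under small
    perturbations of [x]. *)
Lemma key_step (d : nat) (u v : 'I_d -> l1) (p m N : nat) (eps tau : R) :
  (0 < p)%N -> (0 < m)%N -> (1 < N)%N -> 0 < eps -> 0 < tau ->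
  (forall i, hi (u i) p) -> (forall i, hi (v i) p) ->
  exists (x : 'I_d -> l1) (p' M : nat),
    [/\ forall i, hi (x i) p', forall i j, (j < p)%N -> x i j = u i j,
        forall i, nrm (x i - u i) <= eps &
        forall l : 'I_d -> {posnum R}, (forall i, in_box N (l i)) ->
        exists2 n, (0 < n <= M)%N & forall i q, (0 < q <= m)%N ->
        nrm (iter n (wshift (weights_bounded hw (l i))) (x i ^+ q) -
             (q == m)%:R *: v i) <= tau].
Proof.
move=> p0 m0 N1 eps0 tau0 up vp.
have N0 : (0 < N)%N by exact: ltnW.
pose sg := (2 * p).+1.
(* Half of [eps] goes to the monomial and half to the blocks; [b] is the coefficient [m c^(m-1)]
   that multiplies a block in the [m]-th power. *)
pose c : C := (eps / 2)%:C%C.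
pose b : R := m%:R * (eps / 2) ^+ m.-1.
have b0 : 0 < b by rewrite mulr_gt0 ?ltr0n// exprn_gt0// divr_gt0.
pose A : R := 2 + \sum_i nrm (u i) + eps.
pose V : R := 1 + \sum_i nrm (v i).
have le_sum (z : 'I_d -> l1) i : nrm (z i) <= \sum_i nrm (z i).
  by rewrite (bigD1 i)//= lerDl sumr_ge0// => *; exact: nrm_ge0.
have sum_ge0 (z : 'I_d -> l1) : 0 <= \sum_i nrm (z i).
  by rewrite sumr_ge0// => *; exact: nrm_ge0.
have A1 : 1 <= A by have := sum_ge0 u; rewrite /A; lra.
have V1 : 1 <= V by have := sum_ge0 v; rewrite /V; lra.
have V0 : 0 < V by exact: lt_le_trans V1.
have nrm_c k : nrm (c *: monom R k) <= eps / 2.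
  rewrite nrmZ normc_real ger0_norm ?divr_ge0 ?(ltW eps0)//.
  by rewrite -[leRHS]mulr1 ler_wpM2l ?nrm_monom// divr_ge0// ltW.
have aA i : nrm (u i + c *: monom R sg) + 1 <= A.
  have := nrmD (u i) (c *: monom R sg); have := nrm_c sg; have := le_sum u i.
  rewrite /A; lra.
pose om : R := Num.min 1 (tau / (6 * V)).
have om0 : 0 < om by rewrite lt_min ltr01 divr_gt0 ?mulr_gt0.
have om1 : om <= 1 by rewrite ge_min lexx.
have omV i : 3 * om * nrm (v i) <= tau / 2.
  have : om <= tau / (6 * V) by rewrite ge_min lexx orbT.
  rewrite ler_pdivlMr ?mulr_gt0// => h.
  have : om * nrm (v i) <= om * V.
    by rewrite ler_wpM2l ?(ltW om0)//; have := le_sum v i; rewrite /V; lra.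
  lra.
have th0 : 0 < ln (1 + om) by rewrite ln_gt0// ltrDl.
(* With [g = (C0 + 1) t] nodes per axis, a parameter error of [N / g] changes [rho] at indices up to
   [2^(2t)] by a factor at most [1 + om]. *)
have [C0 hC0] := nat_ge (3 * N%:R / ln (1 + om)).
pose G : R := V * (2 * p%:R) ^+ N / b.
have G0 : 0 < G by rewrite divr_gt0 ?mulr_gt0 ?exprn_gt0 ?mulr_gt0 ?ltr0n.
(* 14 comes from [2(6Q + 1) <= 14 Q], and 4 from the 2 of the block estimate and the allowance
   [tau / 2]. *)
pose B : R := 14 ^+ N * (4 * m%:R ^+ 2 * A ^+ m) / tau.
have B0 : 0 <= B by rewrite divr_ge0 ?(ltW tau0)// !mulr_ge0 ?exprn_ge0// (le_trans ler01).
(* The three summands make the total norm of the blocks at most 1, at most [eps / 2], and small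
   enough for the error [tau / 2]. *)
have [K1 hK1] := nat_ge (1 + G * (1 + 2 / eps + B)).
have [t [s [t0 sE [hms hQs hy]]]] := scale_choice d m sg N K1 C0.
have s0 : (0 < s)%N by rewrite sE expn_gt0.
pose g := (C0.+1 * t)%N.
have g0 : (0 < g)%N by rewrite muln_gt0.
pose F := {ffun 'I_d -> 'I_g}.
pose Q := (g ^ d)%N.
have card_F : #|F| = (g ^ d)%N by rewrite card_ffun !card_ord.
have QE : Q = (g ^ d)%N by [].
have Q0 : (0 < Q)%N by rewrite QE expn_gt0 g0.
rewrite -/g -QE in hQs hy.
clearbody Q.
pose nn (f : F) := ((2 * Q + enum_rank f) * s)%N.
have sg8 : (8 * sg <= s)%N by apply: leq_trans hms; rewrite mulnAC leq_pmulr.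
have ps : (p <= s)%N by apply: leq_trans sg8; rewrite /sg; clear; lia.
have nn_bnd f : (2 * Q * s <= nn f <= 3 * Q * s)%N.
  rewrite /nn !leq_mul2r; have : (enum_rank f < Q)%N by rewrite QE -card_F; exact: ltn_ord.
  by move=> e; clear -e; apply/andP; split; apply/orP; right; lia.
have nn_lt f h : (nn f < nn h)%N = (enum_rank f < enum_rank h)%N.
  by rewrite ltn_mul2r s0 ltn_add2l.
have nn_gap f h : (nn f < nn h)%N -> (nn f + s <= nn h)%N.
  by rewrite nn_lt /nn -mulSnr leq_mul2r => e; clear -e; apply/orP; right; lia.
have nn_inj : injective nn.
  move=> f h /eqP; rewrite eqn_mul2r eqn0Ngt s0/= eqn_add2l => /eqP e.
  by apply: enum_rank_inj; exact: val_inj.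
have grid_gt0 (r : R) : 0 <= r -> 0 < N%:R^-1 + r by move=> r0; rewrite ltr_wpDr// invr_gt0 ltr0n.
have cell_ge0 k : 0 <= N.-1%:R * (k%:R / g%:R) :> R by rewrite mulr_ge0 ?divr_ge0.
pose mu (f : F) i := PosNum (grid_gt0 _ (cell_ge0 (f i))).
have muE f i : (mu f i)%:num = N%:R^-1 + N.-1%:R * ((f i)%:R / g%:R) by [].
have muge f i : N%:R^-1 <= (mu f i)%:num by rewrite muE lerDl.
have mule f i : (mu f i)%:num <= N%:R.
  rewrite muE -[in leRHS](prednK N0) -(natr1 N.-1) addrC lerD//.
    by rewrite ler_piMr// ler_pdivrMr ?ltr0n// mul1r ler_nat ltnW.
  by rewrite invf_le1 ?ltr0n// ler1n.
pose W i f := l1_trunc p (fun j =>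
  (rho w (mu f i) j / (b * rho w (mu f i) (nn f + j)))%:C%C * v i j).
(* One power of [Q] pays for the number of blocks, the other [N] for the factor [(14 Q)^N] of the
   block estimate. *)
pose y : R := K1%:R * Q%:R ^+ N.+1.
have K10 : 0 < K1%:R :> R.
  apply: lt_le_trans hK1; rewrite ltr_wpDr// mulr_ge0 ?(ltW G0)// addr_ge0//.
  by rewrite addr_ge0 ?divr_ge0 ?(ltW eps0).
have Q0R : 0 < Q%:R :> R by rewrite ltr0n.
have Q1R : 1 <= Q%:R :> R by rewrite ler1n.
have y0 : 0 < y by rewrite mulr_gt0// exprn_gt0.
have yn f : y ^+ N <= (nn f)%:R.
  have /andP[h _] := nn_bnd f; apply: le_trans hy _; rewrite ler_nat.
  by apply: leq_trans h; rewrite leq_pmull// muln_gt0.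
have nW i f : nrm (W i f) <= G / y.
  apply: le_trans (nrm_target hw (vp i) b0 (mule f i) N0 (muge f i) y0 (yn f)) _.
  have vV : nrm (v i) <= V by have := le_sum v i; rewrite /V; lra.
  rewrite [leLHS]mulrC /G -!mulrA; apply: ler_wpM2r => //.
  by rewrite !mulr_ge0 ?exprn_ge0 ?mulr_ge0 ?invr_ge0 ?(ltW b0) ?(ltW y0).
have etaE i : \sum_f nrm (W i f) <= G / K1%:R / Q%:R ^+ N.
  apply: le_trans (_ : \sum_(f : F) G / y <= _); first exact: ler_sum.
  rewrite sumr_const (_ : #|_| = Q) ?card_F// -[leLHS]mulr_natr /y exprS.
  have : Q%:R ^+ N != 0 :> R by rewrite expf_neq0// gt_eqF.
  move: (Q%:R ^+ N) => z z0.
  suff -> : G / (K1%:R * (Q%:R * z)) * Q%:R = G / K1%:R / z by [].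
  by field; rewrite z0 !gt_eqF.
have GE : G * (1 + 2 / eps + B) = G + G * 2 / eps + G * B.
  by rewrite [LHS]mulrDr [X in X + _ = _]mulrDr mulr1 (mulrA G).
have Ge0 : 0 <= G * 2 / eps by apply: divr_ge0 (ltW eps0); apply: mulr_ge0 => //; exact: ltW.
have GB0 : 0 <= G * B by apply: mulr_ge0 => //; exact: ltW.
rewrite {}GE in hK1.
have GK1 : G <= K1%:R by lra.
have GK2 : G * 2 <= K1%:R * eps by rewrite -ler_pdivrMr//; lra.
have GK3 : G * B <= K1%:R by lra.
have QN1 : 1 <= Q%:R ^+ N :> R by rewrite exprn_ege1.
have QN0 : 0 < Q%:R ^+ N :> R by exact: lt_le_trans QN1.
have eta_le i : \sum_f nrm (W i f) <= G / K1%:R.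
  apply: le_trans (etaE i) _; rewrite ler_pdivrMr// ler_peMr//.
  by rewrite divr_ge0 ?ltW.
have eta1 i : \sum_f nrm (W i f) <= 1.
  by apply: le_trans (eta_le i) _; rewrite ler_pdivrMr// mul1r.
have eta_eps i : \sum_f nrm (W i f) <= eps / 2.
  apply: le_trans (eta_le i) _; rewrite ler_pdivrMr//.
  by move: GK2; move: K1%:R => z; lra.
have Wp i f : hi (W i f) p by exact: hi_trunc.
have msg : (m.-1 * sg <= s)%N.
  by apply: leq_trans hms; rewrite leq_mul2r; apply/orP; right; clear; lia.
have nn_big f : (2 * s <= nn f)%N.
  by have /andP[h _] := nn_bnd f; apply: leq_trans h; rewrite leq_mul2r leq_pmulr// orbT.
have sgs : (2 * sg <= s)%N by apply: leq_trans sg8; rewrite leq_mul2r orbT.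
have Qs : (s <= Q * s)%N by rewrite leq_pmull.
exists (fun i => u i + c *: monom R sg + \sum_f monom R (nn f - m.-1 * sg) * W i f).
exists (4 * Q * s)%N, (3 * Q * s)%N; split.
- move=> i; apply: hiD; first apply: hiD.
  + by apply: hiW (up i); clear -ps Qs; lia.
  + by apply/hiZ; apply: hiW (@hi_monom R sg); clear -sgs Qs sg; lia.
  + apply: hi_sum => f _; apply: hiW (@block_hi R F nn (W i) m p sg p0 (Wp i) f).
    by have /andP[_ h] := nn_bnd f; clear -h ps Qs; lia.
- move=> i j jp; rewrite !l1_coefD l1_coefZ (@lo_monom R) ?mulr0 ?addr0; last
     by rewrite /sg; clear -jp; lia.
  rewrite (@lo_sum _ _ _ _ _ p) ?addr0// => f _.
  by apply: loW (@block_lo R F nn (W i) m sg f); have := nn_big f; clear -msg ps; lia.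
- move=> i; rewrite addrC -addrA addKr.
  apply: le_trans (nrmD _ _) _.
  have := nrm_c sg; have := eta_eps i.
  have := @nrm_blocks R F nn (W i) m sg xpredT; lra.
move=> l lb.
have N1R : 0 < N.-1%:R :> R by rewrite ltr0n; clear -N1; lia.
have g0R : 0 < g%:R :> R by rewrite ltr0n.
have Ni0 : 0 < N%:R^-1 :> R by rewrite invr_gt0 ltr0n.
(* The parameter measured in grid cells; rounding down selects the node, and [l i <= N - 1] gives
   [z i < g]. *)
pose z i : R := ((l i)%:num - N%:R^-1) * (g%:R / N.-1%:R).
have z0 i : 0 <= z i.
  by have /andP[h _] := lb i; rewrite mulr_ge0 ?subr_ge0// divr_ge0// ltW.
have zg i : (Num.truncn (z i) < g)%N.
  rewrite truncn_lt_nat// /z mulrA ltr_pdivrMr// mulrC ltr_pM2l//.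
  by have /andP[_ h] := lb i; rewrite ltrBlDr (le_lt_trans h)// ltrDl.
pose f : F := [ffun i => Ordinal (zg i)].
exists (nn f).
  have /andP[_ ->] := nn_bnd f; rewrite andbT.
  by have := nn_big f; move: s0; clear; lia.
have dist i : `|(l i)%:num - (mu f i)%:num| <= N%:R / g%:R.
  have -> : (l i)%:num - (mu f i)%:num = N.-1%:R / g%:R * (z i - (Num.truncn (z i))%:R).
    rewrite muE /f ffunE /= /z; move: (Num.truncn _) => k.
    by field; rewrite ?gt_eqF// ltr0n.
  have /andP[k1 k2] := truncn_itv (z0 i).
  rewrite normrM ger0_norm ?divr_ge0// -[leRHS]mulr1; apply: ler_pM => //.
  - by rewrite ler_wpM2r ?invr_ge0// ler_nat leq_pred.
  by rewrite ger0_norm ?subr_ge0// lerBlDl natr1 ltW.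
have l_le i : (l i)%:num <= N%:R.
  by have /andP[_ h] := lb i; rewrite (le_trans h)// ler_nat leq_pred.
have exp_le r : r <= N%:R / g%:R -> expR (r * (2 * t).+1%:R) <= 1 + om.
  move=> rg; rewrite -[leRHS]lnK ?posrE ?addr_gt0// ler_expR.
  apply: le_trans (_ : N%:R / g%:R * (3 * t%:R) <= _).
    apply: le_trans (_ : N%:R / g%:R * (2 * t).+1%:R <= _); first by rewrite ler_wpM2r.
    by rewrite ler_wpM2l ?divr_ge0// -natrM ler_nat; clear -t0; lia.
  rewrite mulrAC ler_pdivrMr// /g natrM mulrA [leRHS]mulrA ler_wpM2r//.
  move: hC0; rewrite ler_pdivrMr// -natr1; lra.
have close i j : (j <= nn f + p)%N ->
    rho w (l i) j <= (1 + om) * rho w (mu f i) j /\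
    rho w (mu f i) j <= (1 + om) * rho w (l i) j.
  (* All relevant indices are at most [4Qs <= s^2 = 2^(2t)]. *)
  move=> jn; have jt : (j <= 2 ^ (2 * t))%N.
    rewrite mul2n -addnn expnD -sE; apply: leq_trans jn _.
    have /andP[_ h] := nn_bnd f.
    apply: (@leq_trans (4 * Q * s)); first by clear -h ps Qs; lia.
    by rewrite leq_mul2r hQs orbT.
  split.
    apply: le_trans (rho_lipschitz hw (l i) (mu f i) jt) _.
    by rewrite ler_wpM2r ?(ltW (rho_gt0 hw _ _))// exp_le.
  apply: le_trans (rho_lipschitz hw (mu f i) (l i) jt) _.
  by rewrite ler_wpM2r ?(ltW (rho_gt0 hw _ _))// exp_le// distrC.
move=> i q qm.
have est := @block_estimate R w hw F nn (W i) m p sg s Q (u i) c A m0 p0 (leqnn _)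
  Q0 hms nn_bnd nn_gap nn_inj (up i) (Wp i) A1 (aA i) (eta1 i) (l i) N q f (l_le i) qm.
have om01 : 0 <= om <= 1 by rewrite om1 ltW.
have mn : (m.-1 * sg <= nn f)%N by apply: leq_trans msg _; have := nn_big f; clear; lia.
have tgt := @shift_target R w hw (v i) p _ (nn f) b om (l i) (mu f i)
  (vp i) b0 mn om01 (close i).
have bE : m%:R * c ^+ m.-1 = b%:C%C.
  rewrite /b [RHS]rmorphM [X in _ = _ * X]rmorphXn; congr (_ * _).
  by rewrite [RHS](rmorph_nat (real_complex R)).
rewrite -bE in tgt.
set X := iter _ _ (_ ^+ q) in est *.
set Y := iter _ _ _ in est tgt.
have -> : X - (q == m)%:R *: v i = (X - (q == m)%:R *: Y) + (q == m)%:R *: (Y - v i).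
  by rewrite scalerBr addrA subrK.
apply: le_trans (nrmD _ _) _.
have h1 : nrm (X - (q == m)%:R *: Y) <= tau / 2.
  apply: le_trans est _.
  apply: le_trans (_ : (14 * Q%:R) ^+ N * (2 * m%:R ^+ 2 * A ^+ m * (G / K1%:R / Q%:R ^+ N)) <= _).
    apply: ler_pM.
    - by rewrite exprn_ge0 ?mulr_ge0.
    - rewrite !mulr_ge0 ?exprn_ge0// ?(le_trans ler01 A1)//.
      by rewrite sumr_ge0// => *; exact: nrm_ge0.
    - rewrite lerXn2r ?nnegrE ?mulr_ge0//.
      by rewrite -!natrM ler_nat; clear -Q0; lia.
    by rewrite ler_wpM2l// !mulr_ge0 ?exprn_ge0// (le_trans ler01 A1).
  have -> : (14 * Q%:R) ^+ N * (2 * m%:R ^+ 2 * A ^+ m * (G / K1%:R / Q%:R ^+ N))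
     = G * B / K1%:R * (tau / 2).
    rewrite exprMn /B; move: (Q%:R ^+ N) QN0 (14 ^+ N) (A ^+ m) => z1 z10 z2 z3.
    by field; rewrite !gt_eqF.
  by rewrite ler_piMl ?divr_ge0 ?(ltW tau0)// ler_pdivrMr// mul1r.
have h2 : nrm ((q == m)%:R *: (Y - v i)) <= tau / 2.
  rewrite nrmZ; case: (q == m); last by rewrite normc0 mul0r divr_ge0// ltW.
  by rewrite (normc1 R) mul1r; exact: le_trans tgt _.
lra.
Qed.

End KeyStep.

(** * Passing to the limit *)

Section Limit.
Variable R : realType.
Local Notation C := R[i].
Local Notation l1 := (l1 R).

Lemma nrm_subX (x z : l1) (B e : R) q : 1 <= B -> nrm x <= B -> nrm z <= B ->
  nrm (z - x) <= e -> nrm (z ^+ q - x ^+ q) <= q%:R * B ^+ q * e.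
Proof.
move=> B1 xB zB zx; have B0 : 0 <= B by exact: le_trans B1.
have e0 : 0 <= e by exact: le_trans (nrm_ge0 _) zx.
elim: q => [|q IHq]; first by rewrite !expr0 subrr nrm0 !mul0r.
have -> : z ^+ q.+1 - x ^+ q.+1 = z * (z ^+ q - x ^+ q) + (z - x) * x ^+ q.
  by rewrite !exprS; ring.
apply: le_trans (nrmD _ _) _.
have h1 : nrm (z * (z ^+ q - x ^+ q)) <= B * (q%:R * B ^+ q * e).
  by apply: le_trans (nrmM _ _) _; apply: ler_pM; rewrite ?nrm_ge0.
have h2 : nrm ((z - x) * x ^+ q) <= e * B ^+ q.+1.
  apply: le_trans (nrmM _ _) _; apply: ler_pM; rewrite ?nrm_ge0//.
  apply: le_trans (nrmX _ _) _; apply: le_trans (_ : B ^+ q <= _).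
    by rewrite lerXn2r ?nnegrE ?nrm_ge0.
  by rewrite exprS ler_peMl// exprn_ge0.
apply: le_trans (lerD h1 h2) _; rewrite le_eqVlt; apply/orP; left; apply/eqP.
by rewrite -natr1 exprS; ring.
Qed.

(** * A Baire-type scheme for countably many conditions *)

Section Generic.
Variables (d : nat) (Good : nat -> ('I_d -> l1) -> Prop).
Hypothesis Good_step : forall t (u : 'I_d -> l1) p (eps : R), 0 < eps ->
  (forall i, hi (u i) p) -> exists (x : 'I_d -> l1) p' (delta : R),
  [/\ forall i, hi (x i) p', forall i j, (j < p)%N -> x i j = u i j,
      forall i, nrm (x i - u i) <= eps, 0 < delta &
      forall z : 'I_d -> l1, (forall i, nrm (z i - x i) <= delta) -> Good t z].

(** A stage consists of a finitely supported vector, a bound on its support, and the radius of a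
    ball that later stages never leave. *)
Let state := {s : ('I_d -> l1) * nat * R | (forall i, hi (s.1.1 i) s.1.2) /\ 0 < s.2}.
Let vec (s : state) := (sval s).1.1.
Let len (s : state) := (sval s).1.2.
Let rad (s : state) := (sval s).2.

(* Stages only modify coefficients of larger and larger index, so the limit is
   defined coefficientwise and no completeness is needed. *)
Lemma good_limit (u0 : 'I_d -> l1) p0 : (forall i, hi (u0 i) p0) ->
  exists2 x : 'I_d -> l1, forall t, Good t x &
    forall i j, (j < p0)%N -> x i j = u0 i j.
Proof.
move=> u0p.
have next (ts : nat * state) : exists s' : state,
    [/\ (len ts.2 < len s')%N,
        forall i j, (j < len ts.2)%N -> vec s' i j = vec ts.2 i j,
        forall i, nrm (vec s' i - vec ts.2 i) <= rad ts.2 / 2,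
        rad s' <= rad ts.2 / 2 &
        forall z : 'I_d -> l1, (forall i, nrm (z i - vec s' i) <= rad s') -> Good ts.1 z].
  case: ts => t [[[u p] eps] /= [up eps0]].
  have e20 : 0 < eps / 2 by rewrite divr_gt0.
  have [x [p' [delta [xp' xu xue delta0 xG]]]] := Good_step t e20 up.
  (* The support bound increases strictly, so each coefficient is eventually frozen; the radius at
     least halves, so the later moves fit in the remaining half of the ball. *)
  have st : (forall i, hi ((x, maxn p.+1 p', Num.min (eps / 2) delta).1.1 i)
      (x, maxn p.+1 p', Num.min (eps / 2) delta).1.2) /\
      0 < (x, maxn p.+1 p', Num.min (eps / 2) delta).2.
    split=> [i|] /=; first by apply: hiW (xp' i); exact: leq_maxr.
    by rewrite lt_min e20.
  exists (exist _ (x, maxn p.+1 p', Num.min (eps / 2) delta) st); split => //=.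
  - by rewrite /len/= leq_max ltnSn.
  - by rewrite /rad/= ge_min lexx.
  move=> z zx; apply: xG => i; apply: le_trans (zx i) _.
  by rewrite /rad/= ge_min lexx orbT.
have [f hf] := choice next.
have st0 : (forall i, hi ((u0, p0, 1 : R).1.1 i) (u0, p0, 1 : R).1.2) /\
  0 < (u0, p0, 1 : R).2 by split => /=.
pose S := fix S t : state := if t is t'.+1 then f (t', S t') else exist _ (u0, p0, 1 : R) st0.
have SS t : S t.+1 = f (t, S t) by [].
have [len0 vec0] : len (S 0) = p0 /\ vec (S 0) = u0 by [].
clearbody S.
have rad0 s : 0 < rad s by case: s => s [].
have len_ge t : (t <= len (S t))%N.
  elim: t => // t IHt; apply: leq_ltn_trans IHt _.
  by rewrite SS; case: (hf (t, S t)).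
have len_le t k : (len (S t) <= len (S (k + t)))%N.
  elim: k => // k IHk; apply: leq_trans IHk _; apply: ltnW.
  by rewrite addSn SS; case: (hf ((k + t)%N, S (k + t)%N)).
have agree t k i j : (j < len (S t))%N -> vec (S (k + t)%N) i j = vec (S t) i j.
  elim: k => // k IHk jt; rewrite -IHk// addSn SS.
  have [_ h _ _ _] := hf ((k + t)%N, S (k + t)%N); apply: h => /=.
  exact: leq_trans (len_le t k).
have near t k i : nrm (vec (S (k + t)%N) i - vec (S t) i) <= rad (S t).
  elim: k t => [|k IHk] t; first by rewrite subrr nrm0 ltW.
  have [_ _ h1 h2 _] := hf (t, S t).
  rewrite -(subrKA (vec (S t.+1) i)); apply: le_trans (nrmD _ _) _.
  have := IHk t.+1; rewrite addnS -addSn; move: (h1 i) h2; rewrite -SS /=; lra.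
(* Stage [j + 1] has support bound greater than [j], so its coefficient [j] is final. *)
pose x i j := vec (S j.+1) i j.
have xE i j k : (j < k)%N -> vec (S k) i j = x i j.
  move=> jk; rewrite /x -(agree j.+1 (k - j.+1)%N); first by rewrite subnK.
  exact: len_ge.
have x_l1 i : x i \in @l1_pred R.
  apply: (@l1_pred_bounded _ _ (nrm (vec (S 0) i) + rad (S 0))) => n.
  apply: le_trans (_ : \sum_(0 <= j < n) normc (vec (S n) i j) <= _).
    rewrite big_nat_cond [leRHS]big_nat_cond; apply: ler_sum => j /andP[/andP[_ jn] _].
    by rewrite xE.
  apply: le_trans (nrm_ge_partial _ _) _.
  rewrite -[vec (S n) i](subrK (vec (S 0) i)) addrC; apply: le_trans (nrmD _ _) _.
  by rewrite lerD2l; have := near 0 n i; rewrite addn0.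
pose X i : l1 := L1 (x_l1 i).
(* The first [n] coefficients of [X] are those of stage [n + t], so each partial sum is bounded by
   [near]. *)
have X_near t i : nrm (X i - vec (S t) i) <= rad (S t).
  apply: nrm_le => n; apply: le_trans (near t n i).
  apply: le_trans (nrm_ge_partial _ n).
  rewrite big_nat_cond [leRHS]big_nat_cond; apply: ler_sum => j /andP[/andP[_ jn] _].
  by rewrite !l1_coefD !l1_coefN /X/= -(@xE i j (n + t)%N)// (leq_trans jn)// leq_addr.
exists X => [t|i j jp].
  have [_ _ _ _ h] := hf (t, S t); apply: h => i; rewrite -SS; exact: X_near.
by rewrite /X/= /x -[j.+1]addn0 agree ?len0// vec0.
Qed.

End Generic.

Variables (w : {posnum R} -> nat -> R) (hw : power_weights w \/ linear_weights w).

Definition approximates_powers d m N (tau : R) (v x : 'I_d -> l1) :=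
  forall l : 'I_d -> {posnum R}, (forall i, in_box N (l i)) ->
  exists2 n, (0 < n)%N & forall i q, (0 < q <= m)%N ->
    nrm (iter n (wshift (weights_bounded hw (l i))) (x i ^+ q) -
         (q == m)%:R *: v i) <= tau.

(** The key step is applied with [tau / 2]; the other half absorbs the passage from [x] to [z],
    since powers are Lipschitz on bounded sets and the iterates up to [M] have bounded norm. *)
Lemma approximates_step d m N (tau : R) (v : 'I_d -> l1) r :
  (0 < m)%N -> (1 < N)%N -> 0 < tau -> (forall i, hi (v i) r) ->
  forall (u : 'I_d -> l1) p (eps : R), 0 < eps ->
  (forall i, hi (u i) p) -> exists (x : 'I_d -> l1) p' (delta : R),
  [/\ forall i, hi (x i) p', forall i j, (j < p)%N -> x i j = u i j,
      forall i, nrm (x i - u i) <= eps, 0 < delta &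
      forall z : 'I_d -> l1, (forall i, nrm (z i - x i) <= delta) ->
        approximates_powers m N tau v z].
Proof.
move=> m0 N1 tau0 vr u p eps eps0 up.
have t20 : 0 < tau / 2 by rewrite divr_gt0.
pose P := (maxn p r).+1.
have uP i : hi (u i) P by apply: hiW (up i); rewrite /P ltnW// ltnS leq_maxl.
have vP i : hi (v i) P by apply: hiW (vr i); rewrite /P ltnW// ltnS leq_maxr.
have [x [p' [M [xp' xu xue xv]]]] :=
  @key_step R w hw d u v P m N eps (tau / 2) isT m0 N1 eps0 t20 uP vP.
pose B : R := 2 + \sum_i nrm (x i).
have xB i : nrm (x i) + 2 <= B.
  have h : 0 <= \sum_(j | j != i) nrm (x j) by rewrite sumr_ge0// => *; exact: nrm_ge0.
  by rewrite /B (bigD1 i)//=; lra.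
have B1 : 1 <= B.
  have : 0 <= \sum_i nrm (x i) by rewrite sumr_ge0// => *; exact: nrm_ge0.
  rewrite /B; lra.
pose K : R := (2 * M.+1%:R) ^+ N * (m%:R * B ^+ m).
have K0 : 0 < K.
  by rewrite !mulr_gt0 ?exprn_gt0 ?mulr_gt0 ?ltr0n// (lt_le_trans ltr01).
exists x, p', (Num.min 1 (tau / 2 / K)); split => //.
- by move=> i j jp; apply: xu; rewrite /P ltnS; apply: leq_trans (ltnW jp) _; exact: leq_maxl.
- by rewrite lt_min ltr01 divr_gt0.
move=> z zx l lN; have [n /andP[n0 nM] h] := xv l lN.
exists n => // i q qm; have := h i q qm => {}h.
have lN' : (l i)%:num <= N%:R.
  by have /andP[_ /le_trans] := lN i; apply; rewrite ler_nat leq_pred.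
have /andP[z1 z2] : (nrm (z i - x i) <= 1) && (nrm (z i - x i) <= tau / 2 / K).
  by rewrite -le_min.
have zB : nrm (z i) <= B.
  by have := nrmD (z i - x i) (x i); rewrite subrK; have := xB i; lra.
have xB' : nrm (x i) <= B by have := xB i; lra.
have dz := nrm_subX q B1 xB' zB z2.
set S := iter n _ in h *.
have -> : S (z i ^+ q) - (q == m)%:R *: v i =
   S (z i ^+ q - x i ^+ q) + (S (x i ^+ q) - (q == m)%:R *: v i).
  by rewrite /S shiftB addrA subrK.
apply: le_trans (nrmD _ _) _.
suff : nrm (S (z i ^+ q - x i ^+ q)) <= tau / 2 by lra.
apply: le_trans (nrm_shift_any hw n _ lN') _.
apply: le_trans (_ : (2 * M.+1%:R) ^+ N * (m%:R * B ^+ m * (tau / 2 / K)) <= _).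
  apply: ler_pM; rewrite ?nrm_ge0 ?exprn_ge0 ?mulr_ge0//.
    by rewrite lerXn2r ?nnegrE ?mulr_ge0// ler_wpM2l// ler_nat ltnS.
  apply: le_trans dz _; have /andP[_ qm'] := qm.
  rewrite ler_wpM2r ?(le_trans _ z2) ?nrm_ge0//.
  apply: ler_pM; rewrite ?exprn_ge0 ?(le_trans ler01 B1)// ?ler_nat//.
  by rewrite ler_weXn2l.
by rewrite mulrA -/K mulrC divfK// gt_eqF.
Qed.

End Limit.

(** * Density *)

Section Density.
Variable R : realType.
Local Notation C := R[i].
Local Notation l1 := (l1 R).

(** The filter of boxes converges to [y]: the product topology is a supremum, so this is checked one
    coordinate at a time. *)
Lemma open_box d (O : set (l1_pow R d)) (y : l1_pow R d) : open O -> O y ->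
  exists2 r : R, 0 < r &
    forall z : l1_pow R d, (forall i, nrm (z i - y i) < r) -> O z.
Proof.
move=> oO Oy.
pose B (r : R) : set (l1_pow R d) := [set z | forall i, nrm (z i - y i) < r].
pose F : set_system ('I_d -> l1) := filter_from [set r | 0 < r] B.
have FF : Filter F.
  apply: filter_from_filter; first by exists 1 => /=.
  move=> r1 r2 /= r10 r20; exists (Num.min r1 r2); first by rewrite /= lt_min r10.
  move=> z zr; split=> i; have := zr i; rewrite lt_min => /andP[]//.
have Fy : F --> y.
  apply/cvg_sup => i A /= [_ [[D Dop <-] Dy sDA]].
  have /nbhs_ballP[e /= e0 eA] : nbhs (y i) D by exact: open_nbhs_nbhs.
  (* Radii live in [R[i]], where being positive means being real with positive real part. *)
  exists (complex.Re e) => [|z zr] /=; first by move: e0; rewrite ltcE => /andP[].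
  apply/sDA/eA; rewrite -ball_normE/= distrC normr_nrm.
  move: e0; case: e zr {eA} => a b /= zr; rewrite !ltcE/= => /andP[/eqP -> _].
  by rewrite eqxx zr.
have [r r0 rO] := Fy _ (open_nbhs_nbhs (conj oO Oy)).
by exists r.
Qed.

Definition crat (q : rat * rat) : C := (ratr q.1 +i* ratr q.2)%C.
(** Targets are coded by finite sequences of rational pairs, a countable type that can be
    enumerated. *)
Definition rat_vec (s : seq (rat * rat)) : l1 :=
  l1_trunc (size s) (fun j => crat (nth (0, 0) s j)).

Lemma normc_le_abs (a b : R) : normc (a +i* b)%C <= `|a| + `|b|.
Proof.
rewrite /= -[leRHS]ger0_norm ?addr_ge0// -sqrtr_sqr ler_wsqrtr//.
rewrite -(real_normK (num_real a)) -(real_normK (num_real b)) sqrrD.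
by rewrite -addrA lerD2l lerDr mulrn_wge0// mulr_ge0.
Qed.

Lemma crat_dense (c : C) (e : R) : 0 < e -> exists q, normc (crat q - c) <= e.
Proof.
move=> e0; have e20 : 0 < e / 2 by rewrite divr_gt0.
have h (x : R) : exists q : rat, `|ratr q - x| <= e / 2.
  have [q] : exists q, ratr q \in `]x, (x + e / 2)%R[ by apply: rat_in_itvoo; rewrite ltrDl.
  rewrite in_itv/= => /andP[q1 q2]; exists q.
  by rewrite ger0_norm ?subr_ge0 ?(ltW q1)//; lra.
case: c => a b; have [q1 h1] := h a; have [q2 h2] := h b.
exists (q1, q2); apply: le_trans (normc_le_abs _ _) _.
by rewrite [e]splitr; apply: lerD.
Qed.

(** Cutting off the tail of [y] costs [e / 2], and approximating the [n] remaining coefficients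
    costs the other half. *)
Lemma rat_vec_dense (y : l1) (e : R) : 0 < e -> exists s, nrm (rat_vec s - y) <= e.
Proof.
move=> e0; have e20 : 0 < e / 2 by rewrite divr_gt0.
have [n yn] : exists n, nrm y - e / 2 < \sum_(0 <= k < n) normc (y k).
  apply/not_existsP => h.
  suff : nrm y <= nrm y - e / 2 by lra.
  by apply: nrm_le => n; rewrite leNgt; apply/negP; exact: h.
have en0 : 0 < e / 2 / n.+1%:R by rewrite divr_gt0.
have [q hq] := choice (fun k => crat_dense (y k) en0).
exists (mkseq q n); set z := _ - y.
have zE k : z k = rat_vec (mkseq q n) k - y k by [].
clearbody z; rewrite /rat_vec in zE.
apply: nrm_le => m.
apply: le_trans (_ : \sum_(0 <= k < n + m) normc (z k) <= _).
  rewrite [leRHS](@big_cat_nat _ _ _ m) ?leq_addl//= lerDl sumr_ge0// => *.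
  exact: normc_ge0'.
rewrite (@big_cat_nat _ _ _ n) ?leq_addr//= [e]splitr; apply: lerD.
  apply: le_trans (_ : \sum_(0 <= k < n) e / 2 / n.+1%:R <= _).
    rewrite big_nat_cond [leRHS]big_nat_cond; apply: ler_sum => k /andP[/andP[_ kn] _].
    by rewrite zE l1_truncE size_mkseq kn nth_mkseq.
  rewrite sumr_const_nat subn0 -[leLHS]mulr_natr mulrAC ler_pdivrMr ?ltr0n//.
  by rewrite ler_wpM2l ?(ltW e20)// ler_nat.
apply: le_trans (_ : \sum_(n <= k < n + m) normc (y k) <= _).
  rewrite big_nat_cond [leRHS]big_nat_cond; apply: ler_sum => k /andP[/andP[nk _] _].
  by rewrite zE l1_truncE size_mkseq ltnNge nk/= add0r normcN.
have := nrm_ge_partial y (n + m); rewrite (@big_cat_nat _ _ _ n) ?leq_addr//=.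
lra.
Qed.

Lemma horner_algE (x : l1) (P : {poly C}) :
  horner_alg x P = \sum_(q < size P) P`_q *: x ^+ q.
Proof.
rewrite -[P in LHS]coefK poly_def linear_sum/=; apply: eq_bigr => q _.
by rewrite linearZ/= rmorphXn/= horner_algX mulr_algl.
Qed.

End Density.

(** * The hypercyclic algebra *)

Section Generator.
Variable R : realType.
Local Notation C := R[i].
Local Notation l1 := (l1 R).
Variables (w : {posnum R} -> nat -> R) (hw : power_weights w \/ linear_weights w).

Lemma iter_prod_wshift d (l : 'I_d -> {posnum R}) n (x : l1_pow R d) i :
  iter n (prod_wshift (fun i => weights_bounded hw (l i))) x i =
  iter n (wshift (weights_bounded hw (l i))) (x i).
Proof. by elim: n => // n IHn; rewrite !iterS -IHn. Qed.

(** The conditions are indexed by the countably many triples [(m, N, s)], with [N] governing both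
    the box and the tolerance. Starting from the unit with its coefficient 0 frozen keeps every
    [x i] nonzero. *)
Lemma exists_generator d : exists2 x : 'I_d -> l1,
  forall m N (s : 'I_d -> seq (rat * rat)),
    approximates_powers hw m.+1 N.+2 N.+1%:R^-1 (fun i => rat_vec R (s i)) x &
  forall i, x i != 0.
Proof.
pose Good t (x : 'I_d -> l1) :=
  match unpickle t : option (nat * nat * {ffun 'I_d -> seq (rat * rat)}) with
  | Some (m, N, s) =>
      approximates_powers hw m.+1 N.+2 N.+1%:R^-1 (fun i => rat_vec R (s i)) x
  | None => True
  end.
have step t (u : 'I_d -> l1) p (eps : R) : 0 < eps ->
  (forall i, hi (u i) p) -> exists (x : 'I_d -> l1) p' (delta : R),
  [/\ forall i, hi (x i) p', forall i j, (j < p)%N -> x i j = u i j,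
      forall i, nrm (x i - u i) <= eps, 0 < delta &
      forall z : 'I_d -> l1, (forall i, nrm (z i - x i) <= delta) -> Good t z].
  move=> eps0 up; rewrite /Good; case: unpickle => [[[m N] s]|].
    have t0 : 0 < N.+1%:R^-1 :> R by rewrite invr_gt0 ltr0n.
    apply: (@approximates_step R w hw d m.+1 N.+2 N.+1%:R^-1
      (fun i => rat_vec R (s i)) (\max_i size (s i))) => // i.
    by apply: hiW (@hi_trunc _ _ _); exact: (leq_bigmax i).
  by exists u, p, 1; split=> // i; rewrite subrr nrm0 ltW.
have u0p (i : 'I_d) : hi (1 : l1) 1 by rewrite -monom0; exact: hi_monom.
have [x xG x1] := @good_limit R d Good step (fun=> 1) 1 u0p.
exists x => [m N s|i].
  have := xG (pickle ((m, N), [ffun i => s i])); rewrite /Good pickleK.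
  have -> : (fun i => rat_vec R ([ffun i => s i] i)) = (fun i => rat_vec R (s i)).
    by apply/funext => i; rewrite ffunE.
  by [].
apply/eqP => xi; have := x1 i 0 isT; rewrite xi l1_coef0 l1_coef1 => /esym/eqP.
by rewrite oner_eq0.
Qed.

(** With [c] the leading coefficient of [P], the target is near [c^-1 y]: the top power contributes
    about [y], the lower ones almost nothing. The power 0, which is not controlled, is absent from
    [P]. *)
Lemma hypercyclic_poly d (x : 'I_d -> l1) (P : {poly C}) (l : 'I_d -> {posnum R}) :
  (forall m N (s : 'I_d -> seq (rat * rat)),
    approximates_powers hw m.+1 N.+2 N.+1%:R^-1 (fun i => rat_vec R (s i)) x) ->
  P != 0 -> P`_0 = 0 ->
  hypercyclic (prod_wshift (fun i => weights_bounded hw (l i)))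
    ((fun i => horner_alg (x i) P) : l1_pow R d).
Proof.
move=> xG P0 P00 O [y Oy] oO.
have [r r0 rO] := open_box oO Oy.
pose c := lead_coef P; have c0 : c != 0 by rewrite lead_coef_eq0.
have sP : (1 < size P)%N.
  rewrite ltnNge; apply/negP => /size1_polyC PE; move: P0.
  by rewrite PE P00 eqxx.
pose m := (size P).-2.
have mE : size P = m.+2 by rewrite /m; case: (size P) sP => [|[|]].
have nc0 : 0 < normc c.
  by rewrite lt_neqAle normc_ge0' andbT; apply: contraNneq c0 => /esym/eq0_normc ->.
have e0 : 0 < r / 4 / normc c by rewrite !divr_gt0.
have [s hs] := choice (fun i => rat_vec_dense (c^-1 *: y i) e0).
pose K : R := \sum_(q < size P) normc P`_q.
have K0 : 0 <= K by apply: sumr_ge0 => q _; exact: normc_ge0'.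
(* [N] bounds each parameter and its inverse, so that the box contains them, and makes the total
   error of the powers at most [r / 4]. *)
have [N hN] := nat_ge (\sum_i ((l i)%:num + (l i)%:num^-1) + 4 * K / r).
have KR0 : 0 <= 4 * K / r by rewrite divr_ge0 ?mulr_ge0 ?(ltW r0)//.
have lsum i : (l i)%:num + (l i)%:num^-1 <= \sum_i ((l i)%:num + (l i)%:num^-1).
  by rewrite [leRHS](bigD1 i)//= lerDl sumr_ge0// => j _; rewrite addr_ge0 ?invr_ge0.
have lbox i : in_box N.+2 (l i).
  have l0 : 0 < (l i)%:num by [].
  have li0 : 0 < (l i)%:num^-1 by rewrite invr_gt0.
  have := lsum i => h.
  have h1 : (l i)%:num <= N%:R by lra.
  have h2 : (l i)%:num^-1 <= N%:R by lra.
  rewrite /in_box; apply/andP; split; last first.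
    by apply: le_trans h1 _; rewrite ler_nat.
  rewrite -[leRHS]invrK lef_pV2 ?posrE ?ltr0n//.
  by apply: le_trans h2 _; rewrite ler_nat !leqW.
have [n n0 hn] := xG m N s l lbox.
exists (iter n (prod_wshift (fun i => weights_bounded hw (l i)))
  ((fun i => horner_alg (x i) P) : l1_pow R d)).
split; last by exists n.
apply: rO => i; rewrite iter_prod_wshift horner_algE shift_sum.
set S := iter n _; set v := rat_vec R (s i).
have -> : \sum_(q < size P) S (P`_q *: x i ^+ q) - y i =
    \sum_(q < size P) P`_q *: (S (x i ^+ q) - ((q : nat) == m.+1)%:R *: v) +
    c *: (v - c^-1 *: y i).
  have mP : (m.+1 < size P)%N by rewrite mE.
  rewrite scalerBr scalerA divff// scale1r addrA; congr (_ - _).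
  transitivity (\sum_(q < size P) (P`_q *: (S (x i ^+ q) - ((q : nat) == m.+1)%:R *: v) +
     P`_q *: (((q : nat) == m.+1)%:R *: v))).
    by apply: eq_bigr => q _; rewrite -scalerDr subrK /S shiftZ.
  rewrite big_split/=; congr (_ + _).
  rewrite (bigD1 (Ordinal mP))//= eqxx scale1r big1 ?addr0 => [|q qm].
    by rewrite /c lead_coefE mE.
  suff -> : (q : nat) == m.+1 = false by rewrite scale0r scaler0.
  by apply: contra_neqF qm => /eqP e; apply: val_inj.
apply: le_lt_trans (nrmD _ _) _.
have h1 : nrm (c *: (v - c^-1 *: y i)) <= r / 4.
  by rewrite nrmZ mulrC -ler_pdivlMr// hs.
have h2 : nrm (\sum_(q < size P)
    P`_q *: (S (x i ^+ q) - ((q : nat) == m.+1)%:R *: v)) <= r / 4.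
  apply: le_trans (nrm_sum _ _ _) _.
  apply: le_trans (_ : \sum_(q < size P) normc P`_q * N.+1%:R^-1 <= _).
    apply: ler_sum => q _; rewrite nrmZ.
    have [q0|q0] := posnP q; first by rewrite q0 P00 normc0 !mul0r.
    rewrite ler_wpM2l ?normc_ge0'//; apply: hn.
    by rewrite q0 -ltnS -mE ltn_ord.
  rewrite -mulr_suml -/K ler_pdivrMr ?ltr0n//.
  have : 4 * K / r <= N.+1%:R.
    apply: le_trans (_ : N%:R <= _); last by rewrite ler_nat.
    by apply: le_trans hN; rewrite lerDr sumr_ge0.
  move=> h; have : 4 * K <= N.+1%:R * r by rewrite -ler_pdivrMr.
  lra.
lra.
Qed.

End Generator.

Theorem theorem1p4 (R : realType) (w : {posnum R} -> nat -> R)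
    (hw : power_weights w \/ linear_weights w) (d : nat) (hd : (1 <= d)%N) :
  common_hypercyclic_algebra
    (fun lambda : 'I_d -> {posnum R} =>
       prod_wshift (fun i => weights_bounded hw (lambda i))).
Proof.
have [x xG x0] := exists_generator hw d.
pose gen (y : l1_pow R d) := exists2 P : {poly R[i]}, P`_0 = 0 &
  y = (fun i => horner_alg (x i) P).
exists (fun y => `[< gen y >]); split.
- split; first by apply/asboolP; exists 0; [rewrite coef0|apply/funext => i; rewrite rmorph0].
  move=> c y z /asboolP[P P0 ->] /asboolP[Q Q0 ->]; apply/asboolP.
  exists (c *: P + Q); first by rewrite coefD coefZ P0 Q0 mulr0 addr0.
  by apply/funext => i; rewrite [RHS]raddfD [X in _ = X + _]linearZ/= mulr_algl.
- move=> y z /asboolP[P P0 ->] /asboolP[Q Q0 ->]; apply/asboolP.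
  exists (P * Q); first by rewrite coefM big_ord1 P0 mul0r.
  by apply/funext => i; rewrite rmorphM.
- exists x.
    by apply/asboolP; exists 'X; [rewrite coefX|apply/funext => i; rewrite horner_algX].
  (* Since [d >= 1] there is a coordinate at which [x] is nonzero. *)
  apply/eqP => xE; have := x0 (Ordinal hd); rewrite xE; case/eqP; by [].
move=> y /asboolP[P P0 yE] y0 l; rewrite yE; apply: hypercyclic_poly => //.
apply: contraNneq y0 => PE; apply/eqP; rewrite yE PE.
by apply/funext => i; rewrite rmorph0.
Qed.
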